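(* Let $\rho(r)$ be an arbitrary proximate order and let $\mu\in\mathfrak M_\infty(\rho(r))$. Then: 1) $Fr[\mu]$ is a nonempty compact set; 2) $Fr[\mu]$ is a connected set in the metric space $(\mathfrak R_c,d)$; 3) for every $t>0$ the set $Fr[\mu]$ is invariant under the transformation $F_t$, and moreover $F_t$ is a one-to-one mapping of $Fr[\mu]$ onto itself.
   Context: Proximate orders: a zero proximate order is a real function $\hat\rho(r)$ on $(0,\infty)$ (possibly undefined at $r=1$) such that $\lim_{r\to\infty}\hat\rho(r)=0$; $\hat\rho(1/r)=-\hat\rho(r)$; $\hat\rho$ is continuously differentiable on $(0,\infty)\setminus\{1\}$; $\lim_{r\to\infty}r\ln r\,\hat\rho'(r)=0$; and $r^{\hat\rho(r)}$ extends continuously to $r=1$ with value $1$. A proximate order is a function $\rho(r)=\rho+\hat\rho(r)$ with $\rho\in\mathbb R$ and $\hat\rho$ a zero proximate order; $\rho=\rho(\infty)=\lim_{r\to\infty}\rho(r)$. Put $V(r)=r^{\rho(r)}$ (so $V(1)=1$). Radon measures: a real Radon measure on $(0,\infty)$ is $\mu=\mu_1-\mu_2$ with $\mu_1,\mu_2$ mutually singular positive Borel measures, finite on compact subsets of $(0,\infty)$; a complex Radon measure is $\mu_1+i\mu_2$ with $\mu_1,\mu_2$ real Radon measures. $|\mu|$ is the total variation. $\mathfrak R_c$ is the space of complex Radon measures on $(0,\infty)$. $\Phi$ is the space of continuous functions on $(0,\infty)$ with support in some $[a,b]\subset(0,\infty)$; $f_n\to f$ in $\Phi$ means that all supports lie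 in one common $[a,b]\subset(0,\infty)$ and $f_n\to f$ uniformly. Write $(\mu,\varphi)=\int_0^\infty\varphi\,d\mu$. Wide convergence $\mu_n\to\mu$ means $(\mu_n,\varphi)\to(\mu,\varphi)$ for all $\varphi\in\Phi$. Compactness of a set of Radon measures refers to wide convergence of sequences. Metric: fix a sequence $\varphi_n$ in $\Phi$ such that every $\varphi\in\Phi$ is a limit in $\Phi$ of a subsequence of $\varphi_n$, and put $$d(\mu_1,\mu_2)=\sum_{n=1}^\infty\frac{|(\mu_1-\mu_2,\varphi_n)|}{2^n(1+|(\mu_1-\mu_2,\varphi_n)|)}.$$ Class: $\mathfrak M_\infty(\rho(r))$ is the set of Radon measures on $(0,\infty)$ with $\sup_{r\ge1}|\mu|([r,er])/V(r)<\infty$. Azarin limit set: $\mu_t(E)=\mu(tE)/V(t)$, $t>0$; $Fr[\mu]$ is the set of all Radon measures $\nu$ of the form $\nu=\lim_{n\to\infty}\mu_{t_n}$ (wide convergence) with $t_n\to+\infty$. The map $F_t=F_t(\rho)$ on Radon measures is $(F_t\nu)(E)=t^{-\rho}\nu(tE)$. *)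

(* Defs.v *)
From HB Require Import structures.
From mathcomp Require Import all_boot all_order all_algebra.
From mathcomp Require Import all_classical all_reals all_analysis.
From mathcomp Require Import measurable_realfun complex.

Set Implicit Arguments.
Unset Strict Implicit.
Unset Printing Implicit Defensive.

Import Order.TTheory GRing.Theory Num.Theory.
Import numFieldNormedType.Exports.

Local Open Scope classical_set_scope.
Local Open Scope ring_scope.
Local Open Scope complex_scope.

(* The usual topology of the complex numbers, induced by the modulus. *)
HB.instance Definition _ (R : rcfType) :=
  PseudoMetricNormedZmod.copy R[i] (R[i] : numFieldType)^o.

Section proximate_order.
Context {R : realType}.
Implicit Types (rho hat : R -> R).

(* The value [hat 1] is irrelevant: no clause mentions it. *)
Definition zero_proximate_order hat : Prop :=
  [/\ hat r @[r --> +oo%R] --> (0 : R),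
      forall r : R, 0 < r -> r != 1 -> hat r^-1 = - hat r,
      forall r : R, 0 < r -> r != 1 ->
        derivable hat r 1 /\ {for r, continuous (derive1 hat)},
      r * ln r * derive1 hat r @[r --> +oo%R] --> (0 : R)
    & r `^ hat r @[r --> (1 : R)^'] --> (1 : R)].

Definition proximate_order rho : Prop :=
  exists (rho0 : R) hat,
    zero_proximate_order hat /\ forall r : R, 0 < r -> r != 1 ->
      rho r = rho0 + hat r.

Definition rho_infty rho : R := lim (rho r @[r --> +oo%R]).

(* [1 `^ x = 1] for all [x], so that [Vord rho 1 = 1] whatever [rho 1] is. *)
Definition Vord rho (r : R) : R := r `^ rho r.

End proximate_order.

Section radon.
Context (R : realType).

Local Notation TR := (measurableTypeR R).

(* A measure on the half-line is encoded as a Borel measure on the line that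
   gives mass 0 to the complement of the half-line. Library measures are total
   functions on [set R]; requiring the value 0 on sets that are not Borel makes
   [=] coincide with equality of measures. *)
Record pos_radon := PosRadon {
  pos_measure :> {measure set TR -> \bar R} ;
  pos_radon_out : pos_measure (~` `]0, +oo[) = 0%E ;
  pos_radon_fin : forall K : set R, compact K -> K `<=` `]0, +oo[ ->
    (pos_measure K < +oo)%E ;
  pos_radon_nm : forall E : set TR, ~ measurable E -> pos_measure E = 0%E
}.

Definition mutually_singular (m1 m2 : pos_radon) : Prop :=
  exists P : set TR, [/\ measurable P, m1 P = 0%E & m2 (~` P) = 0%E].

Record real_radon := RealRadon {
  rpos : pos_radon ;
  rneg : pos_radon ;
  real_radon_sing : mutually_singular rpos rneg
}.

Record complex_radon := ComplexRadon {
  re_radon : real_radon ;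
  im_radon : real_radon
}.

HB.instance Definition _ := gen_eqMixin complex_radon.
HB.instance Definition _ := gen_choiceMixin complex_radon.

(* Values of a signed or complex Radon measure; meaningful on the sets
   satisfying [rel_compact], where both Jordan components are finite. *)
Definition real_val (mu : real_radon) (E : set R) : R :=
  fine (rpos mu E) - fine (rneg mu E).

Definition complex_val (mu : complex_radon) (E : set R) : R[i] :=
  real_val (re_radon mu) E +i* real_val (im_radon mu) E.

Definition rel_compact (E : set R) : Prop :=
  exists a b : R, 0 < a /\ E `<=` `[a, b].

(* The pieces of the partitions are relatively compact in the half-line, where
   [complex_val] is meaningful. *)
Definition total_variation (mu : complex_radon) (E : set R) : \bar R :=
  ereal_sup [set s | exists F : nat -> set TR,
    [/\ forall k, measurable (F k), forall k, rel_compact (F k),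
        trivIset setT F, \bigcup_k F k = E
      & s = (\sum_(0 <= k <oo) (Normc.normc (complex_val mu (F k)))%:E)%E]].

Definition real_integral (mu : real_radon) (f : R -> R) : R :=
  \int[rpos mu]_(x in `]0, +oo[) f x - \int[rneg mu]_(x in `]0, +oo[) f x.

Definition pairing (mu : complex_radon) (phi : R -> R[i]) : R[i] :=
  let re x := complex.Re (phi x) in
  let im x := complex.Im (phi x) in
  (real_integral (re_radon mu) re - real_integral (im_radon mu) im) +i*
  (real_integral (re_radon mu) im + real_integral (im_radon mu) re).

(* Test functions on the half-line are extended by 0 to the line. *)
Definition supported (a b : R) (phi : R -> R[i]) : Prop :=
  forall x, ~ (a <= x <= b) -> phi x = 0.

Definition Phi : set (R -> R[i]) :=
  [set phi : R -> R[i] | continuous phi /\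
    exists a b : R, 0 < a /\ supported a b phi].

Definition Phi_cvg (f : nat -> R -> R[i]) (g : R -> R[i]) : Prop :=
  (exists a b : R, 0 < a /\ forall n, supported a b (f n)) /\
  {uniform, f @ \oo --> g}.

Definition subseq_dense (phi : nat -> R -> R[i]) : Prop :=
  (forall n, Phi (phi n)) /\
  forall psi, Phi psi -> exists k : nat -> nat,
    increasing_seq k /\ Phi_cvg (phi \o k) psi.

Definition wide_cvg (mu : nat -> complex_radon) (nu : complex_radon) : Prop :=
  forall phi, Phi phi -> pairing (mu n) phi @[n --> \oo] --> pairing nu phi.

Definition wide_compact (A : set complex_radon) : Prop :=
  forall u : nat -> complex_radon, (forall n, A (u n)) ->
    exists k : nat -> nat, increasing_seq k /\
      exists nu, A nu /\ wide_cvg (u \o k) nu.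

(* [(mu1 - mu2, phi n)] is computed as [(mu1, phi n) - (mu2, phi n)]. *)
Definition radon_dist_term (phi : nat -> R -> R[i]) (mu1 mu2 : complex_radon)
    (n : nat) : R :=
  let p := Normc.normc (pairing mu1 (phi n) - pairing mu2 (phi n)) in
  p / (2 ^+ n.+1 * (1 + p)).

Definition radon_dist (phi : nat -> R -> R[i]) (mu1 mu2 : complex_radon) : R :=
  limn (series (radon_dist_term phi mu1 mu2)).

Definition Minfty (rho : R -> R) : set complex_radon :=
  [set mu | (ereal_sup [set s | exists2 r : R, (1 <= r)%R &
      s = total_variation mu `[r, (expR 1 * r)%R] * ((Vord rho r)^-1)%:E]
    < +oo)%E].

End radon.

Section dilation.
Context {R : realType}.
Local Notation TR := (measurableTypeR R).
Implicit Types (c t : {posnum R}).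

Definition scale_set t (E : set R) : set R := [set t%:num * x | x in E].

Lemma scale_setE t : scale_set t = preimage (fun x : R => t%:num^-1 * x).
Proof.
apply/funext => E; apply/seteqP; split=> [_ [x Ex <-]|x /= Ex] /=.
  by rewrite mulKf.
by exists (t%:num^-1 * x) => //; rewrite mulVKf.
Qed.

Lemma measurable_scale_set t (E : set TR) :
  measurable E -> measurable (scale_set t E : set TR).
Proof.
move=> mE; rewrite scale_setE -[X in measurable X]setTI.
have mf : measurable_fun [set: TR] (fun x : TR => t%:num^-1 * x : TR).
  exact: mulrl_measurable.
exact: mf.
Qed.

Lemma scale_setK t (E : set R) : scale_set (t%:num^-1)%:pos (scale_set t E) = E.
Proof. by rewrite !scale_setE /= -comp_preimage; apply/seteqP; split => x /=;
  rewrite /= invrK mulKf. Qed.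

Lemma scale_setVK t (E : set R) :
  scale_set t (scale_set (t%:num^-1)%:pos E) = E.
Proof. by rewrite !scale_setE /= -comp_preimage; apply/seteqP; split => x /=;
  rewrite /= invrK mulVKf. Qed.

Section pos_dilate.
Context c t (m : pos_radon R).

(* E |-> c * m(tE) *)
Definition pos_dilate_measure (E : set TR) : \bar R :=
  (c%:num%:E * m (scale_set t E))%E.

Let mK := mscale (NngNum (ltW [gt0 of c%:num])) m.

Let pos_dilate0 : pos_dilate_measure set0 = 0%E.
Proof.
by rewrite /pos_dilate_measure scale_setE preimage_set0 measure0 mule0.
Qed.

Let pos_dilate_ge0 E : (0 <= pos_dilate_measure E)%E.
Proof. by rewrite /pos_dilate_measure mule_ge0. Qed.

Let pos_dilate_sigma_additive : semi_sigma_additive pos_dilate_measure.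
Proof.
move=> F mF tF mUF.
have -> : pos_dilate_measure (\bigcup_n F n) =
    mK (\bigcup_n (scale_set t (F n))).
  by rewrite /pos_dilate_measure scale_setE preimage_bigcup.
apply: (@measure_semi_sigma_additive _ _ _ mK (fun n => scale_set t (F n))).
- by move=> n; exact: measurable_scale_set.
- apply/trivIsetP => i j _ _ ij; rewrite scale_setE -preimage_setI.
  by move/trivIsetP : tF => /(_ _ _ _ _ ij) -> //; rewrite preimage_set0.
- rewrite scale_setE -preimage_bigcup -scale_setE.
  exact: measurable_scale_set.
Qed.

HB.instance Definition _ := isMeasure.Build _ _ _ pos_dilate_measure
  pos_dilate0 pos_dilate_ge0 pos_dilate_sigma_additive.

Let dilate_out : pos_dilate_measure (~` `]0, +oo[) = 0%E.
Proof.
rewrite /pos_dilate_measure scale_setE.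
rewrite (_ : _ @^-1` _ = ~` `]0, +oo[) ?pos_radon_out ?mule0//.
by apply/seteqP; split=> x /=; rewrite !in_itv/= !andbT pmulr_rgt0 ?invr_gt0.
Qed.

Let dilate_fin (K : set R) : compact K -> K `<=` `]0, +oo[ ->
  (pos_dilate_measure K < +oo)%E.
Proof.
move=> cK K0; apply: lte_mul_pinfty => //; apply: pos_radon_fin.
  apply: continuous_compact => //.
  by apply: continuous_subspaceT => x; exact: mulrl_continuous.
move=> _ [x /K0 + <-]; rewrite /= !in_itv/= !andbT => x0.
by rewrite mulr_gt0.
Qed.

Let dilate_nm (E : set TR) : ~ measurable E -> pos_dilate_measure E = 0%E.
Proof.
move=> nE; rewrite /pos_dilate_measure pos_radon_nm ?mule0// => mE.
apply: nE; rewrite -[E](scale_setK t); exact: measurable_scale_set.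
Qed.

Definition pos_dilate : pos_radon R := PosRadon dilate_out dilate_fin dilate_nm.

End pos_dilate.

Lemma dilate_sing c t (mu : real_radon R) :
  mutually_singular (pos_dilate c t (rpos mu)) (pos_dilate c t (rneg mu)).
Proof.
have [P [mP p0 n0]] := real_radon_sing mu.
exists (scale_set (t%:num^-1)%:pos P); split.
- exact: measurable_scale_set.
- by rewrite /= /pos_dilate_measure scale_setVK p0 mule0.
- rewrite scale_setE preimage_setC -scale_setE /= /pos_dilate_measure.
  by rewrite scale_setVK n0 mule0.
Qed.

Definition real_dilate c t (mu : real_radon R) : real_radon R :=
  RealRadon (dilate_sing c t mu).

Definition dilate c t (mu : complex_radon R) : complex_radon R :=
  ComplexRadon (real_dilate c t (re_radon mu)) (real_dilate c t (im_radon mu)).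

Lemma dilate_val c t (mu : complex_radon R) (E : set R) :
  complex_val (dilate c t mu) E =
  (c%:num)%:C * complex_val mu (scale_set t E).
Proof.
have fineZ (y : \bar R) : fine (c%:num%:E * y)%E = c%:num * fine y.
  by case: y => [y||]//=; rewrite mulr0 ?gt0_muley ?gt0_muleNy ?lte_fin.
apply/eqP; rewrite eq_complex /= /real_val /= /pos_dilate_measure !fineZ.
by rewrite !mul0r subr0 addr0 !mulrBr !eqxx.
Qed.

End dilation.

Section limit_set.
Context {R : realType}.
Implicit Types (rho : R -> R) (t : {posnum R}) (mu nu : complex_radon R).

Lemma Vord_inv_gt0 rho t : 0 < (Vord rho t%:num)^-1.
Proof. by rewrite invr_gt0 powR_gt0. Qed.

(* E |-> mu(tE) / V(t) *)
Definition azarin rho t mu : complex_radon R :=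
  dilate (PosNum (Vord_inv_gt0 rho t)) t mu.

Definition Fr rho mu : set (complex_radon R) :=
  [set nu | exists t : nat -> {posnum R},
     (t n)%:num @[n --> \oo] --> +oo%R /\
     wide_cvg (fun n => azarin rho (t n) mu) nu].

Lemma Ft_factor_gt0 rho t : 0 < t%:num `^ (- rho_infty rho).
Proof. by rewrite powR_gt0. Qed.

(* E |-> t^(- rho(oo)) * nu(tE) *)
Definition Ft rho t nu : complex_radon R :=
  dilate (PosNum (Ft_factor_gt0 rho t)) t nu.

Lemma azarin_val rho t mu (E : set R) :
  complex_val (azarin rho t mu) E =
  complex_val mu [set t%:num * x | x in E] / (Vord rho t%:num)%:C.
Proof. by rewrite dilate_val mulrC /= fmorphV. Qed.

Lemma Ft_val rho t nu (E : set R) :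
  complex_val (Ft rho t nu) E =
  (t%:num `^ (- rho_infty rho))%:C * complex_val nu [set t%:num * x | x in E].
Proof. exact: dilate_val. Qed.

End limit_set.

Section radon_metric.
Context {R : realType} (phi : nat -> R -> R[i]).
Implicit Types (mu nu : complex_radon R).

Let pd mu nu n : R := Normc.normc (pairing mu (phi n) - pairing nu (phi n)).

Let pd_ge0 mu nu n : 0 <= pd mu nu n.
Proof. by rewrite /pd; case: (_ - _) => a b; exact: sqrtr_ge0. Qed.

Let pdC mu nu n : pd mu nu n = pd nu mu n.
Proof. by rewrite /pd -opprB normcN. Qed.

Let pdD mu1 mu2 mu3 n : pd mu1 mu3 n <= pd mu1 mu2 n + pd mu2 mu3 n.
Proof.
rewrite /pd (_ : pairing mu1 _ - _ =
  (pairing mu1 (phi n) - pairing mu2 (phi n)) +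
  (pairing mu2 (phi n) - pairing mu3 (phi n))) ?le_normcD//.
by rewrite addrA subrK.
Qed.

Let termE mu nu n :
  radon_dist_term phi mu nu n =
  (2 ^+ n.+1)^-1 * (pd mu nu n / (1 + pd mu nu n)).
Proof. by rewrite /radon_dist_term -/(pd mu nu n) invfM mulrCA. Qed.

Lemma radon_dist_term_ge0 mu nu n : 0 <= radon_dist_term phi mu nu n.
Proof.
by rewrite termE mulr_ge0 ?invr_ge0 ?exprn_ge0 ?divr_ge0 ?addr_ge0 ?pd_ge0.
Qed.

Lemma radon_dist_termC mu nu n :
  radon_dist_term phi mu nu n = radon_dist_term phi nu mu n.
Proof. by rewrite !termE pdC. Qed.

Lemma radon_dist_termD mu1 mu2 mu3 n :
  radon_dist_term phi mu1 mu3 n <=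
  radon_dist_term phi mu1 mu2 n + radon_dist_term phi mu2 mu3 n.
Proof.
rewrite !termE -mulrDr ler_wpM2l ?invr_ge0 ?exprn_ge0//.
have a0 := pd_ge0 mu1 mu2 n; have b0 := pd_ge0 mu2 mu3 n.
have c0 := pd_ge0 mu1 mu3 n; have := pdD mu1 mu2 mu3 n.
move: (pd mu1 mu2 n) (pd mu2 mu3 n) (pd mu1 mu3 n) a0 b0 c0.
move=> a b c a0 b0 c0 cab.
have a1 : 0 < 1 + a by rewrite ltr_pwDl.
have b1 : 0 < 1 + b by rewrite ltr_pwDl.
have c1 : 0 < 1 + c by rewrite ltr_pwDl.
have fE (x : R) : 0 < 1 + x -> x / (1 + x) = 1 - (1 + x)^-1.
  move=> x1; have n1 := lt0r_neq0 x1; apply: (mulIf n1).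
  by rewrite mulrBl mulVf// divfK// mul1r addrAC subrr add0r.
apply: (@le_trans _ _ ((a + b) / (1 + (a + b)))).
  rewrite !fE ?ltr_pwDl ?addr_ge0// lerB// lef_pV2 ?posrE ?ltr_pwDl ?addr_ge0//.
  by rewrite lerD2l.
rewrite mulrDl lerD// ler_wpM2l// lef_pV2 ?posrE ?ltr_pwDl ?addr_ge0//.
  by rewrite lerD2l lerDl.
by rewrite lerD2l lerDr.
Qed.

Lemma is_cvg_radon_dist mu nu : cvgn (series (radon_dist_term phi mu nu)).
Proof.
have h0 : 0 <= (2^-1 : R) by rewrite invr_ge0.
apply: (@series_le_cvg _ _ (geometric (2^-1 : R) 2^-1)).
- exact: radon_dist_term_ge0.
- by move=> n; rewrite /geometric /= mulr_ge0 ?exprn_ge0.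
- move=> n; rewrite termE /geometric /= -exprS exprVn.
  rewrite -[leRHS]mulr1 ler_wpM2l ?invr_ge0 ?exprn_ge0//.
  by rewrite ler_pdivrMr ?mul1r ?lerDr// ltr_pwDl.
- by apply: is_cvg_geometric_series; rewrite ger0_norm// invf_lt1 ?ltr1n.
Qed.

Lemma radon_distxx mu : radon_dist phi mu mu = 0.
Proof.
rewrite /radon_dist (_ : series _ = cst 0) ?lim_cst//.
apply/funext => n; rewrite /series /= big1// => k _.
by rewrite termE /pd subrr Normc.normc0 mul0r mulr0.
Qed.

Lemma radon_distC mu nu : radon_dist phi mu nu = radon_dist phi nu mu.
Proof.
by congr (limn (series _)); apply/funext => n; exact: radon_dist_termC.
Qed.

Lemma radon_distD mu1 mu2 mu3 :
  radon_dist phi mu1 mu3 <= radon_dist phi mu1 mu2 + radon_dist phi mu2 mu3.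
Proof.
rewrite /radon_dist -lim_seriesD; [|exact: is_cvg_radon_dist..].
apply: lim_series_le; [exact: is_cvg_radon_dist| |exact: radon_dist_termD].
by apply: is_cvg_seriesD; exact: is_cvg_radon_dist.
Qed.

End radon_metric.

(* The space of complex Radon measures with the topology of [radon_dist phi].
   Separation of [radon_dist phi] needs [subseq_dense phi]; the topology does
   not, hence the pseudometric interface. *)
Definition radon_metric {R : realType} (phi : nat -> R -> R[i]) : Type :=
  complex_radon R.

Section radon_metric_instance.
Context {R : realType} (phi : nat -> R -> R[i]).
Local Notation M := (radon_metric phi).

HB.instance Definition _ := Choice.on M.

Definition radon_ball (mu : M) (e : R) : set M :=
  [set nu : M | radon_dist phi mu nu < e].

Definition radon_entourage : set_system (M * M) := entourage_ radon_ball.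

Definition radon_nbhs (mu : M) : set_system M := nbhs_ radon_entourage mu.

HB.instance Definition _ := hasNbhs.Build M radon_nbhs.

Lemma radon_nbhsE : @nbhs M M = nbhs_ radon_entourage.
Proof. by []. Qed.

Lemma radon_ball_center (mu : M) (e : R) : 0 < e -> radon_ball mu e mu.
Proof. by move=> e0; rewrite /radon_ball /= radon_distxx. Qed.

Lemma radon_ball_sym (mu nu : M) (e : R) :
  radon_ball mu e nu -> radon_ball nu e mu.
Proof. by rewrite /radon_ball /= radon_distC. Qed.

Lemma radon_ball_triangle (mu1 mu2 mu3 : M) (e1 e2 : R) :
  radon_ball mu1 e1 mu2 -> radon_ball mu2 e2 mu3 ->
  radon_ball mu1 (e1 + e2) mu3.
Proof.
move=> h1 h2; apply: le_lt_trans (radon_distD phi mu1 mu2 mu3) _.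
exact: ltrD.
Qed.

HB.instance Definition _ := @Nbhs_isPseudoMetric.Build R M
  radon_entourage radon_nbhsE radon_ball radon_ball_center radon_ball_sym
  radon_ball_triangle erefl.

End radon_metric_instance.

(* Main.v *)
From HB Require Import structures.
Require Import Defs.
From mathcomp Require Import all_boot all_order all_algebra.
From mathcomp Require Import all_classical all_reals all_analysis.
From mathcomp Require Import complex measurable_realfun.
From mathcomp Require Import ring lra.

Set Implicit Arguments.
Unset Strict Implicit.
Unset Printing Implicit Defensive.

Import Order.TTheory GRing.Theory Num.Theory.
Import numFieldNormedType.Exports.
Local Open Scope classical_set_scope.
Local Open Scope ring_scope.

(** The limit set is the set of limit points, as [t] tends to infinity, of the
    orbit [t |-> mu_t].  The three claims rest on three facts about this orbit.

    The orbit is relatively compact. A proximate order makes [V] regularly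
    varying: [V(ts)/V(t)] tends to [s ^ rho(oo)] ([Vord_ratio], from the mean
    value theorem applied to [hat(r) ln r], whose derivative is [o(1/r)]).
    Together with the growth condition on [mu] this bounds the masses that the
    four Jordan components of [mu_t] give to a fixed segment [[a, b]],
    uniformly for large [t] ([azarin_masses_bounded]). Helly's selection
    principle then produces limits. It is run along an ultrafilter finer than
    the Frechet filter ([helly_ultra]): the distribution functions of each
    component converge pointwise, with no diagonal extraction, and the
    right-continuous regularisation of the limit is the distribution function
    of a Radon measure. The limits of the positive and negative components
    need not be mutually singular, which is repaired by a Hahn decomposition
    on each piece of a countable partition ([jordan_integral]). To return to
    sequences, a countable family of tent functions is shown to decide
    convergence for families of measures with bounded masses
    ([tests_determine]); a subsequence is extracted by following this family
    ([azarin_subsequence]). This gives nonemptiness. Compactness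
    ([Fr_compact]) follows because a sequence in the limit set is shadowed, on
    more and more tents, by a sequence on the orbit.

    The orbit is continuous in the metric [d], at least for [t > 1]
    ([log_orbit_continuous]).  If the limit set were the union of two nonempty
    separated parts [B] and [C], the continuous function
    [dist(mu_t, B) - dist(mu_t, C)] would be negative for arbitrarily large [t]
    and positive for arbitrarily large [t], hence zero at points tending to
    infinity.  A limit point of the orbit along these points would belong to the
    limit set and be equidistant from [B] and [C], which the separation forbids
    ([no_separation], [Fr_connected]).

    The orbit is equivariant up to a factor: [mu_(st)] is
    [V(s) / V(st)] times the dilation by [t] of [mu_s], and the factor tends to
    [t ^ (- rho(oo))].  So [F_t] preserves the limit set ([Ft_Fr]), and
    [F_(1/t)] is its inverse there ([Ft_bij]). *)

(** * Regular variation of V *)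

Section growth.
Context {R : realType}.
Implicit Types (rho hat : R -> R).

Lemma cvg_shift_scale (s : R) : 0 < s -> t * s @[t --> +oo%R] --> +oo%R.
Proof.
move=> s0; apply/cvgryPge => A; near=> t.
by rewrite -ler_pdivrMr//; near: t; exact: nbhs_pinfty_ge (num_real _).
Unshelve. all: by end_near. Qed.

(** The quantity inside the absolute value is the derivative of [hat(u) ln u];
    multiplied by [u] it is the sum of the two expressions that a zero proximate
    order sends to 0. *)
Lemma zero_order_log_slope hat : zero_proximate_order hat ->
  forall e : R, 0 < e -> \forall t \near +oo%R,
    forall u, t <= u -> u * `|derive1 hat u * ln u + hat u * u^-1| <= e.
Proof.
move=> [h0 _ _ h1 _] e e0.
have c : r * ln r * derive1 hat r + hat r @[r --> +oo%R] --> (0 : R).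
  by rewrite -(addr0 0); exact: cvgD.
move/cvgrPdist_le : c => /(_ _ e0) [A [rA HA]].
near=> t => u tu.
have Au : A < u by apply: lt_le_trans tu; near: t; exact: nbhs_pinfty_gt.
have u0 : 0 < u by apply: lt_le_trans tu; near: t; exact: nbhs_pinfty_gt (num_real _).
have := HA _ Au; rewrite sub0r normrN; apply: le_trans.
rewrite -[X in X * _](gtr0_norm u0) -normrM le_eqVlt; apply/orP; left; apply/eqP.
congr `| _ |; field; exact: lt0r_neq0.
Unshelve. all: by end_near. Qed.

Lemma zero_order_log_derive hat (u : R) : zero_proximate_order hat -> 1 < u ->
  is_derive u 1 (fun x => hat x * ln x) (derive1 hat u * ln u + hat u * u^-1).
Proof.
move=> [_ _ hd _ _] u1; have u0 : 0 < u by exact: lt_trans u1.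
have [du _] := hd u u0 (negbT (gt_eqF u1)).
have dl := is_derive1_ln u0.
have dh : is_derive u 1 hat (derive1 hat u).
  by rewrite derive1E; apply: DeriveDef.
apply: is_derive_eq.
by rewrite /GRing.scale /= addrC [ln u * _]mulrC.
Qed.

(** By the mean value theorem on the segment from [t] to [ts], the difference is
    at most [|s - 1| t] times a slope that is [o(1/t)].  The case [s < 1] follows
    by exchanging the end points. *)
Lemma zero_order_log_shift hat (s : R) : zero_proximate_order hat -> 0 < s ->
  hat (t * s) * ln (t * s) - hat t * ln t @[t --> +oo%R] --> (0 : R).
Proof.
move=> hh.
have key (r : R) : 1 <= r ->
    hat (t * r) * ln (t * r) - hat t * ln t @[t --> +oo%R] --> (0 : R).
  move=> r1; apply/cvgrPdist_le => e e0.
  have r0 : 0 < r by exact: lt_le_trans r1.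
  have er : 0 < e / r by rewrite divr_gt0.
  near=> t; rewrite sub0r normrN.
  have t1 : 1 < t by near: t; exact: nbhs_pinfty_gt (num_real _).
  have t0 : 0 < t by exact: lt_trans t1.
  have ttr : t <= t * r by rewrite ler_peMr// ltW.
  have dg x : t <= x -> is_derive x 1 (fun x => hat x * ln x)
      (derive1 hat x * ln x + hat x * x^-1).
    by move=> tx; apply: zero_order_log_derive => //; exact: lt_le_trans tx.
  have [||c ctr ->] := @MVT_segment R (fun x => hat x * ln x)
      (fun x => derive1 hat x * ln x + hat x * x^-1) t (t * r) ttr.
  - by move=> x; rewrite in_itv/= => /andP[/ltW tx _]; exact: dg.
  - apply: derivable_within_continuous => x; rewrite in_itv/= => /andP[tx _].
    by have [] := dg x tx.
  move: ctr; rewrite in_itv/= => /andP[tc ctr].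
  have c0 : 0 < c by exact: lt_le_trans tc.
  have H : c * `|derive1 hat c * ln c + hat c * c^-1| <= e / r.
    move: tc; move: (c); near: t; exact: zero_order_log_slope.
  rewrite normrM (ger0_norm (_ : 0 <= t * r - t)) ?subr_ge0//.
  apply: (@le_trans _ _ (`|derive1 hat c * ln c + hat c / c| * (c * r))).
    rewrite ler_wpM2l//; apply: (@le_trans _ _ (t * r)).
      by rewrite gerBl ltW.
    by rewrite ler_wpM2r// ltW.
  by rewrite mulrCA mulrA -ler_pdivlMr.
move=> s0; have [s1|/ltW s1] := leP 1 s; first exact: key.
have si1 : 1 <= s^-1 by rewrite invf_ge1.
have /cvgN := cvg_comp _ _ (cvg_shift_scale s0) (key _ si1).
rewrite oppr0; apply: cvg_trans; apply: near_eq_cvg; near=> t => /=.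
by rewrite !fctE /= mulfK ?gt_eqF// opprB.
Unshelve. all: by end_near. Qed.

Lemma rho_inftyE rho (rho0 : R) hat : zero_proximate_order hat ->
  (forall r : R, 0 < r -> r != 1 -> rho r = rho0 + hat r) ->
  rho_infty rho = rho0.
Proof.
move=> [h0 _ _ _ _] rhoE; apply/cvg_lim => //.
have : rho0 + hat r @[r --> +oo%R] --> rho0.
  by rewrite -[X in _ --> X]addr0; apply: cvgD => //; exact: cvg_cst.
apply: cvg_trans; apply: near_eq_cvg; near=> t.
have t1 : 1 < t by near: t; exact: nbhs_pinfty_gt (num_real _).
by rewrite rhoE ?gt_eqF// (lt_trans _ t1).
Unshelve. all: by end_near. Qed.

(** [V(r) = exp(rho0 ln r + hat(r) ln r)], and the second term of the exponent
    varies by [o(1)] under dilation. *)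
Lemma Vord_ratio rho (s : R) : proximate_order rho -> 0 < s ->
  Vord rho (t * s) / Vord rho t @[t --> +oo%R] --> s `^ rho_infty rho.
Proof.
move=> [rho0 [hat [hh rhoE]]] s0; rewrite (rho_inftyE hh rhoE).
have c : expR (rho0 * ln s + (hat (t * s) * ln (t * s) - hat t * ln t))
    @[t --> +oo%R] --> expR (rho0 * ln s).
  apply: continuous_cvg; first exact: continuous_expR.
  rewrite -[X in _ --> X]addr0; apply: cvgD; first exact: cvg_cst.
  exact: zero_order_log_shift.
rewrite /powR (gt_eqF s0); apply: cvg_trans c; apply: near_eq_cvg; near=> t.
have t1 : 1 < t by near: t; exact: nbhs_pinfty_gt (num_real _).
have ts1 : 1 < t * s.
  by rewrite -ltr_pdivrMr//; near: t; exact: nbhs_pinfty_gt (num_real _).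
have t0 : 0 < t by exact: lt_trans t1.
have ts0 : 0 < t * s by rewrite mulr_gt0.
rewrite /Vord /powR !gt_eqF// -expRN -expRD !rhoE ?gt_eqF//.
by congr expR; rewrite lnM ?posrE//; ring.
Unshelve. all: by end_near. Qed.

Lemma Vord_continuous rho (t : R) : proximate_order rho -> 1 < t ->
  {for t, continuous (Vord rho)}.
Proof.
move=> [rho0 [hat [hh rhoE]]] t1.
have t0 : 0 < t by exact: lt_trans t1.
have tn1 : t != 1 by rewrite gt_eqF.
have E x : 1 < x -> expR (rho0 * ln x + hat x * ln x) = Vord rho x.
  move=> x1; have x0 : 0 < x by exact: lt_trans x1.
  by rewrite /Vord /powR gt_eqF// rhoE ?gt_eqF// mulrDl.
have c : expR (rho0 * ln x + hat x * ln x) @[x --> t] -->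
   expR (rho0 * ln t + hat t * ln t).
  apply: continuous_cvg; first exact: continuous_expR.
  apply: cvgD.
    by apply: cvgM; [exact: cvg_cst|exact: continuous_ln].
  have [] := zero_order_log_derive hh t1.
  by move=> /derivable1_diffP/differentiable_continuous.
rewrite /prop_for /continuous_at -(E t t1).
apply: cvg_trans c; apply: near_eq_cvg; near=> x; apply: E.
by near: x; exact: lt_nbhsr.
Unshelve. all: by end_near. Qed.

End growth.

(** * Integration of test functions *)

Section integrals.
Context {R : realType}.
Local Notation TR := (measurableTypeR R).
Implicit Types (m : pos_radon R) (r : real_radon R) (f g : R -> R) (a b c w x y : R).

Definition test_on a b f :=
  [/\ 0 < a, continuous f & forall x, ~ (a <= x <= b) -> f x = 0].

Lemma test_on_widen a b a' b' f : 0 < a' -> a' <= a -> b <= b' ->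
  test_on a b f -> test_on a' b' f.
Proof.
move=> a'0 aa bb [a0 cf f0]; split => // x nx; apply: f0 => /andP[ax xb].
by apply: nx; rewrite (le_trans aa ax) (le_trans xb bb).
Qed.

Lemma test_onD a b f g : test_on a b f -> test_on a b g ->
  test_on a b (fun x => f x + g x).
Proof.
move=> [a0 cf f0] [_ cg g0]; split=> // [x|x nx].
  by apply: cvgD; [exact: cf|exact: cg].
by rewrite f0// g0// addr0.
Qed.

Lemma test_onZ a b c f : test_on a b f -> test_on a b (fun x => c * f x).
Proof.
move=> [a0 cf f0]; split=> // [x|x nx]; last by rewrite f0// mulr0.
by apply: cvgM; [exact: cvg_cst|exact: cf].
Qed.

Lemma test_onB a b f g : test_on a b f -> test_on a b g ->
  test_on a b (fun x => f x - g x).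
Proof.
move=> tf /(test_onZ (-1)) /(test_onD tf); congr (test_on a b _).
by apply/funext => x; rewrite mulN1r.
Qed.

Lemma test_on0 a b : 0 < a -> test_on a b (fun=> 0).
Proof. by move=> a0; split => // x; exact: cvg_cst. Qed.

Lemma test_bounded a b f : test_on a b f -> exists2 c, 0 <= c & forall x, `|f x| <= c.
Proof.
move=> [_ cf f0].
have : compact (f @` `[a, b]).
  by apply: continuous_compact (@segment_compact R a b); exact: continuous_subspaceT.
move=> /compact_bounded[M [_ /(_ (`|M| + 1))]].
have M1 : M < `|M| + 1 by rewrite (le_lt_trans (ler_norm _))// ltrDl.
move=> /(_ M1) H; exists (`|M| + 1) => [|x]; first by rewrite addr_ge0.
have [xab|nx] := boolP (a <= x <= b); last first.
  by rewrite f0 ?normr0 ?addr_ge0//; exact/negP.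
by apply: H; exists x => //=; rewrite in_itv.
Qed.

Lemma radon_finite m a b : 0 < a -> (m `[a, b]%classic < +oo)%E.
Proof.
move=> a0; apply: pos_radon_fin; first exact: segment_compact.
by move=> x /=; rewrite !in_itv/= andbT => /andP[+ _]; exact: lt_le_trans.
Qed.

Lemma radon_finite_sub m a b (E : set R) : 0 < a -> measurable (E : set TR) ->
  E `<=` `[a, b] -> (m E < +oo)%E.
Proof.
move=> a0 mE Eab; apply: le_lt_trans (radon_finite m b a0).
by apply: le_measure => //; rewrite inE.
Qed.

Lemma radon_fin_num m a b (E : set R) : 0 < a -> measurable (E : set TR) ->
  E `<=` `[a, b] -> m E \is a fin_num.
Proof.
by move=> a0 mE Eab; rewrite ge0_fin_numE//; exact: radon_finite_sub Eab.
Qed.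

Lemma test_measurable a b f : test_on a b f -> measurable_fun [set: TR] (f : TR -> R).
Proof. by move=> [_ cf _]; exact: continuous_measurable_fun. Qed.

Lemma test_integrable_on m a b a' b' f (E : set R) : test_on a b f -> 0 < a' ->
  measurable (E : set TR) -> E `<=` `[a', b'] -> m.-integrable E (EFin \o f).
Proof.
move=> tf a0 mE Eab; apply: measurable_bounded_integrable => //.
- exact: radon_finite_sub Eab.
- by apply: measurable_funTS; exact: test_measurable tf.
- have [c c0 fc] := test_bounded tf.
  exists c; split; first exact: num_real.
  by move=> x cx y _; exact: le_trans (fc y) (ltW cx).
Qed.

Lemma Rintegral_test m a b f (E D : set R) : measurable (E : set TR) ->
  measurable (D : set TR) -> test_on a b f ->
  `[a, b] `<=` E -> E `<=` D ->
  \int[m]_(x in D) f x = \int[m]_(x in E) f x.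
Proof.
move=> mE mD [_ _ f0] abE ED.
rewrite Rintegral_mkcond [RHS]Rintegral_mkcond; congr Rintegral.
apply/funext => x; rewrite !patchE.
have [xE|nE] := boolP (x \in E).
  by rewrite ifT// inE; apply: ED; rewrite -inE.
rewrite f0; first by case: ifP.
by move=> xab; move/negP: nE; apply; rewrite inE; apply: abE; rewrite /= in_itv.
Qed.

Lemma test_integrable m a b f : test_on a b f ->
  m.-integrable `]0, +oo[ (EFin \o f).
Proof.
move=> tf; have [a0 _ f0] := tf.
have -> : EFin \o f = (EFin \o f) \_ `[a, b].
  apply/funext => x; rewrite patchE; case: ifPn => // /negP.
  by rewrite inE /= in_itv/= => nx; rewrite f0.
apply: (@integrableS _ _ _ _ setT) => //.
by apply/(integrable_mkcond _ _).1 => //; exact: (@test_integrable_on m a b a b).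
Qed.

Definition mint m f : R := \int[m]_(x in `]0, +oo[) f x.

Lemma mintD m a b f g : test_on a b f -> test_on a b g ->
  mint m (fun x => f x + g x) = mint m f + mint m g.
Proof.
move=> tf tg; apply: RintegralD => //; first exact: test_integrable tf.
exact: test_integrable tg.
Qed.

Lemma mintZ m a b c f : test_on a b f -> mint m (fun x => c * f x) = c * mint m f.
Proof. by move=> tf; apply: RintegralZl => //; exact: test_integrable tf. Qed.

Lemma mint_bound m a b c f : test_on a b f -> (forall x, `|f x| <= c) ->
  `|mint m f| <= c * fine (m `[a, b]%classic).
Proof.
move=> tf fc; have [a0 _ _] := tf; rewrite /mint.
have mab : measurable (`[a, b] : set TR) by [].
rewrite (@Rintegral_test m a b f `[a, b]%classic)//; last first.
  by move=> x /=; rewrite !in_itv/= andbT => /andP[+ _]; exact: lt_le_trans.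
have intf :=
  @test_integrable_on m a b a b f `[a, b]%classic tf a0 mab (@subset_refl _ _).
apply: le_trans (le_normr_Rintegral _ _) _ => //.
rewrite -Rintegral_cst//; apply: le_Rintegral => //.
- exact: integrable_norm.
- apply: measurable_bounded_integrable => //; first exact: radon_finite.
  by exists c; split; [exact: num_real|move=> x cx y _; apply: le_trans (ltW cx);
    rewrite ger0_norm// (le_trans _ (fc 0))].
Qed.

Lemma Riemann_step m a b f w x y : test_on a b f -> 0 < x -> x <= y ->
  (forall z, x < z <= y -> `|f z - f x| <= w) ->
  `|\int[m]_(z in `]x, y]) f z - f x * fine (m `]x, y]%classic)|
    <= w * fine (m `]x, y]%classic).
Proof.
move=> tf x0 xy fw.
have mE : measurable (`]x, y] : set TR) by [].
have sE : `]x, y] `<=` `[x, y] by exact: subset_itv_oc_cc.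
have intf := @test_integrable_on m a b x y f _ tf x0 mE sE.
have intc k : m.-integrable `]x, y] (EFin \o cst k).
  apply: measurable_bounded_integrable => //; first exact: radon_finite_sub sE.
  by exists `|k|; split; [exact: num_real|move=> u ku z _; exact: ltW].
have intB : m.-integrable `]x, y] (EFin \o (fun z => f z - f x)).
  apply: eq_integrable (integrableB _ intf (intc (f x))) => //.
rewrite -!Rintegral_cst// -RintegralB//; last exact: intc.
apply: le_trans (le_normr_Rintegral _ _) _ => //.
apply: le_Rintegral => //; first exact: integrable_norm.
exact: intc.
Qed.

(** The bound depends on the oscillation [w] and on the total mass only, so the
    same partition serves a whole family of measures with bounded masses. *)
Lemma Riemann_sum m a b f w (x : nat -> R) N : test_on a b f -> 0 < x 0%N ->
  (forall i, x i <= x i.+1) ->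
  (forall i z, (i < N)%N -> x i < z <= x i.+1 -> `|f z - f (x i)| <= w) ->
  `|\int[m]_(z in `]x 0%N, x N]) f z -
    \sum_(i < N) f (x i) * fine (m `]x i, x i.+1]%classic)|
    <= w * fine (m `]x 0%N, x N]%classic).
Proof.
move=> tf x0 xS; have xm i j : (i <= j)%N -> x i <= x j.
  elim: j => [|j IH]; first by rewrite leqn0 => /eqP->.
  by rewrite leq_eqVlt ltnS => /predU1P[->//|/IH/le_trans]; exact.
elim: N => [|N IH] fw.
  by rewrite set_itvoc0 Rintegral_set0 big_ord0 subr0 normr0 measure0 mulr0.
have U : `]x 0%N, x N.+1]%classic = `]x 0%N, x N] `|` `]x N, x N.+1] :> set R.
  by rewrite -itv_bndbnd_setU// bnd_simp; exact: xm.
have dis : `]x 0%N, x N]%classic `&` `]x N, x N.+1]%classic = set0 :> set R.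
  rewrite -subset0 => z [] /=; rewrite !in_itv/= => /andP[_ zN] /andP[Nz _].
  by move: (lt_le_trans Nz zN); rewrite ltxx.
have fin i j : (m `]x i, x j]%classic \is a fin_num)%E.
  apply: (@radon_fin_num m (x 0%N) (x j)) => //.
  by move=> z /=; rewrite !in_itv/= => /andP[/ltW iz ->]; rewrite (le_trans _ iz) ?xm.
have -> : fine (m `]x 0%N, x N.+1]%classic) =
    fine (m `]x 0%N, x N]%classic) + fine (m `]x N, x N.+1]%classic).
  by rewrite U measureU// fineD; [|exact: fin|exact: fin].
have -> : \int[m]_(z in `]x 0%N, x N.+1]) f z = \int[m]_(z in `]x 0%N, x N]) f z
     + \int[m]_(z in `]x N, x N.+1]) f z.
  rewrite U Rintegral_setU//.
    rewrite -U; apply: (@test_integrable_on m a b (x 0%N) (x N.+1)) => //.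
    exact: subset_itv_oc_cc.
  by apply/disj_set2P; rewrite dis.
rewrite big_ord_recr /= opprD addrACA mulrDr; apply: le_trans (ler_normD _ _) _.
apply: lerD; first by apply: IH => i z iN; apply: fw; exact: ltnW.
apply: (Riemann_step m tf) => //; first by rewrite (lt_le_trans x0)// xm.
by move=> z; exact: fw.
Qed.

End integrals.

(** * Radon measures from distribution functions *)

Section construction.
Context {R : realType}.
Local Notation TR := (measurableTypeR R).
Implicit Types (m : pos_radon R) (a b x y : R).

Lemma compact_pos_segment (K : set R) : compact K -> K `<=` `]0, +oo[ ->
  exists a b, 0 < a /\ K `<=` `[a, b].
Proof.
move=> cK K0; have [->|/set0P Kn0] := eqVneq K set0; first by exists 1, 1; split.
have cid : {within K, continuous (@idfun R)}.
  by apply: continuous_subspaceT => x; exact: cvg_id.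
have [a aK amin] := compact_EVT_min Kn0 cK cid.
have [b bK bmax] := compact_EVT_max Kn0 cK cid.
exists a, b; split.
  by move: aK => /set_mem/K0; rewrite /= in_itv/= andbT.
by move=> x Kx /=; rewrite in_itv/=; apply/andP; split;
  [apply: amin|apply: bmax]; rewrite inE.
Qed.

Section pos_radon_of_measure.
Context (mu : {measure set TR -> \bar R}).
Context (mu_out : mu (~` `]0, +oo[%classic) = 0%E).
Context (mu_fin : forall a b, 0 < a -> (mu `[a, b]%classic < +oo)%E).

(** Sets that are not Borel must have value 0 in [pos_radon]. *)
Definition borel_part (E : set TR) : \bar R :=
  if `[< measurable E >] then mu E else 0%E.

Let borel_partE E : measurable E -> borel_part E = mu E.
Proof. by move=> mE; rewrite /borel_part asboolT. Qed.

Let borel_part0 : borel_part set0 = 0%E.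
Proof. by rewrite borel_partE// measure0. Qed.

Let borel_part_ge0 E : (0 <= borel_part E)%E.
Proof. by rewrite /borel_part; case: ifP. Qed.

Let borel_part_sigma_additive : semi_sigma_additive borel_part.
Proof.
move=> F mF tF mUF; rewrite borel_partE//.
rewrite (_ : (fun n => _) = (fun n => \sum_(0 <= i < n) mu (F i))%E).
  exact: measure_semi_sigma_additive.
by apply/funext => n; apply: eq_bigr => i _; rewrite borel_partE.
Qed.

HB.instance Definition _ := isMeasure.Build _ _ _ borel_part
  borel_part0 borel_part_ge0 borel_part_sigma_additive.

Let borel_part_out : borel_part (~` `]0, +oo[) = 0%E.
Proof. by rewrite borel_partE//; exact: measurableC. Qed.

Let borel_part_fin (K : set R) : compact K -> K `<=` `]0, +oo[ ->
  (borel_part K < +oo)%E.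
Proof.
move=> cK K0; have [a [b [a0 Kab]]] := compact_pos_segment cK K0.
apply: le_lt_trans (mu_fin b a0).
rewrite -[leRHS]borel_partE//; apply: le_measure => //; rewrite inE//.
exact: compact_measurable.
Qed.

Let borel_part_nm (E : set TR) : ~ measurable E -> borel_part E = 0%E.
Proof. by move=> mE; rewrite /borel_part asboolF. Qed.

Lemma pos_radon_of_measure :
  exists m : pos_radon R, forall E : set TR, measurable E -> m E = mu E.
Proof.
exists (PosRadon borel_part_out borel_part_fin borel_part_nm) => E mE /=.
exact: borel_partE.
Qed.

End pos_radon_of_measure.

Lemma expR_preimage_oc x y : (@expR R) @^-1` `]expR x, expR y] = `]x, y]%classic.
Proof. by apply/seteqP; split=> z /=; rewrite !in_itv/= ltr_expR ler_expR. Qed.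

(** The mass near 0 may be infinite, so the distribution function lives on the
    logarithmic scale: the measure is the image under [exp] of the
    Lebesgue-Stieltjes measure of [G] on the line. *)
Lemma stieltjes_pos_radon (G : R -> R) : {homo G : x y / x <= y} ->
    right_continuous G ->
  exists m : pos_radon R, forall x y, x <= y ->
    m `]expR x, expR y]%classic = (G y - G x)%:E.
Proof.
move=> ndG rcG.
pose G' : cumulative R R := HB.pack G (isCumulative.Build _ _ _ G ndG rcG).
have me : measurable_fun [set: TR] (@expR R : TR -> TR) by exact: measurable_expR.
pose nu : {measure set TR -> \bar R} :=
  pushforward (lebesgue_stieltjes_measure G') (@expR R : TR -> TR).
have nuE x y : x <= y -> nu me `]expR x, expR y]%classic = (G y - G x)%:E.
  move=> xy; rewrite /nu /= /pushforward expR_preimage_oc.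
  rewrite /lebesgue_stieltjes_measure/= /measure_extension/=.
  have -> := @measurable_mu_extE _ _ _ (wlength G') _ (is_ocitv x y).
  exact: (wlength_itv_bnd G false false xy).
have [||m mE] := @pos_radon_of_measure (nu me).
- rewrite /nu /= /pushforward (_ : _ @^-1` _ = set0) ?measure0//.
  by rewrite -subset0 => x /=; rewrite in_itv/= expR_gt0.
- move=> a b a0.
  pose x := ln a - 1; pose y := `|ln a| + `|ln b|.
  have xy : x <= y.
    rewrite /x /y lerBlDr (le_trans (ler_norm _))// -addrA lerDl.
    by rewrite addr_ge0.
  apply: (@le_lt_trans _ _ (nu me `]expR x, expR y]%classic)); last first.
    by rewrite nuE// ltry.
  apply: le_measure; rewrite ?inE// => z /=; rewrite !in_itv/= => /andP[az zb].
  have z0 : 0 < z by exact: lt_le_trans az.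
  have b0 : 0 < b by exact: lt_le_trans zb.
  apply/andP; split.
    by apply: lt_le_trans az; rewrite -[ltRHS](lnK a0) ltr_expR /x gtrBl.
  apply: (le_trans zb); rewrite -[leLHS](lnK b0) ler_expR /y.
  by rewrite (le_trans (ler_norm _))// lerDr.
exists m => x y xy; rewrite -nuE//; exact: mE.
Qed.

End construction.

(** * Helly's selection principle along an ultrafilter *)

Section helly.
Context {R : realType}.
Local Notation TR := (measurableTypeR R).
Implicit Types (m : pos_radon R) (a b w x y : R).

(** Heine's theorem; the segment is enlarged by 1 on both sides because one of
    the two points may lie outside of the support. *)
Lemma compactly_supported_unif (f : R -> R) a b w : continuous f ->
    (forall x, ~ (a <= x <= b) -> f x = 0) -> 0 < w ->
  exists2 h, 0 < h & forall x y, `|x - y| < h -> `|f x - f y| <= w.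
Proof.
move=> cf f0 w0.
have cK : compact `[a - 1, b + 1] by exact: segment_compact.
have [] := (compact_near_coveringP `[a - 1, b + 1]).1 cK R (0^'+)
  (fun h x => forall y, `|x - y| < h -> `|f x - f y| <= w) _.
  move=> x _; have w2 : 0 < w / 2 by rewrite divr_gt0.
  have /cvgrPdist_le /(_ _ w2) := cf x.
  rewrite near_nbhs => /nbhs_ballP[d /= d0 fd].
  exists (ball x (d / 2), [set h | h < d / 2]) => /=.
    split; first by apply: nbhsx_ballx; rewrite divr_gt0.
    by apply: nbhs_right_lt; rewrite divr_gt0.
  move=> [z h] [/= xz hd] y zy.
  rewrite (le_trans (ler_distD (f x) _ _))// [leRHS]splitr lerD//.
    rewrite distrC; apply: fd; rewrite /ball/= (lt_le_trans xz)//; lra.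
  apply: fd; rewrite /ball/= (le_lt_trans (ler_distD z _ _))// [ltRHS]splitr.
  by rewrite ltrD// (lt_trans zy).
move=> e /= e0 He; pose h := Num.min (e / 2) 1.
have h0 : 0 < h by rewrite lt_min divr_gt0/=.
exists h => // x y.
have main u v : `|u - v| < h -> a <= u <= b -> `|f u - f v| <= w.
  move=> uv /andP[au ub]; apply: (He h) => //.
    rewrite /= sub0r normrN gtr0_norm// gt_min; apply/orP; left.
    lra.
  rewrite /= in_itv/=; lra.
move=> xy; have [xab|xab] := pselect (a <= x <= b); first exact: main.
have [yab|yab] := pselect (a <= y <= b); first by rewrite distrC main// distrC.
by rewrite !f0// subrr normr0 ltW.
Qed.

Lemma ultra_bounded_cvg (T : Type) (U : set_system T) (u : T -> R) (M : R) :
  UltraFilter U -> U [set n | `|u n| <= M] -> exists l : R, u n @[n --> U] --> l.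
Proof.
move=> UU uM.
have [|l []] := @segment_compact R (- M) M (u @ U) _ _.
  by apply: (@filterS T U) uM => n /=; rewrite in_itv/= -ler_norml.
move=> _ cl; exists l => B nB.
have [//|/= nU] := in_ultra_setVsetC (u @^-1` B) UU.
by have [z []] := cl (~` B) B nU nB.
Qed.

Lemma summation_by_parts (g D : nat -> R) N :
  \sum_(i < N) g i * (D i.+1 - D i) =
  g N * D N - g 0%N * D 0%N - \sum_(i < N) (g i.+1 - g i) * D i.+1.
Proof.
elim: N => [|N IH]; first by rewrite !big_ord0 subrr subr0.
by rewrite !big_ord_recr/= IH; ring.
Qed.

(** Replacing a monotone function [F] by its right-continuous regularisation [G]
    changes Stieltjes sums little, although [F] and [G] may differ at the nodes:
    after summation by parts the difference [G - F] at a node is multiplied by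
    an increment of [g] and is bounded by the increment of [G] over the
    preceding interval.  This is why the nodes need not be points of
    continuity. *)
Lemma Stieltjes_sum_perturb (g F G : nat -> R) w N : g 0%N = 0 -> g N = 0 ->
    (forall i, (i < N)%N -> `|g i.+1 - g i| <= w) ->
    (forall i, F i <= G i) -> (forall i, G i <= F i.+1) ->
  `|\sum_(i < N) g i * (F i.+1 - F i) - \sum_(i < N) g i * (G i.+1 - G i)|
   <= w * (G N - G 0%N).
Proof.
move=> g0 gN gw FG GF; pose D i := G i - F i.
have -> : \sum_(i < N) g i * (F i.+1 - F i) - \sum_(i < N) g i * (G i.+1 - G i)
    = \sum_(i < N) (g i.+1 - g i) * D i.+1.
  rewrite -sumrB -[RHS]opprK -[X in - X](_ : \sum_(i < N) g i * (D i.+1 - D i) = _).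
    by rewrite -sumrN; apply: eq_bigr => i _; rewrite /D; ring.
  by rewrite summation_by_parts g0 gN !mul0r subrr sub0r.
apply: (le_trans (ler_norm_sum _ _ _)).
have -> : w * (G N - G 0%N) = \sum_(i < N) w * (G i.+1 - G i).
  by rewrite -mulr_sumr -(big_mkord xpredT (fun i => G i.+1 - G i)) telescope_sumr.
apply: ler_sum => i _; have wi := gw i (ltn_ord i).
rewrite normrM ler_pM// ger0_norm ?subr_ge0//.
by rewrite /D lerD2l lerN2.
Qed.

End helly.

Section helly_theorem.
Context {R : realType}.
Local Notation TR := (measurableTypeR R).
Implicit Types (m : pos_radon R) (a b w x y : R).

Definition oc_mass m x y : R := fine (m `]x, y]%classic).

Lemma oc_mass0 m x y : y <= x -> oc_mass m x y = 0.
Proof. by move=> yx; rewrite /oc_mass set_itv_ge ?measure0// -leNgt. Qed.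

Lemma oc_mass_ge0 m x y : 0 <= oc_mass m x y.
Proof. by rewrite fine_ge0. Qed.

Lemma oc_mass_fin m x y : 0 < x -> m `]x, y]%classic \is a fin_num.
Proof.
move=> x0; apply: (@radon_fin_num _ m x y) => //; exact: subset_itv_oc_cc.
Qed.

Lemma oc_massD m x y z : 0 < x -> x <= y -> y <= z ->
  oc_mass m x z = oc_mass m x y + oc_mass m y z.
Proof.
move=> x0 xy yz; rewrite /oc_mass -fineD; last 2 first.
- exact: oc_mass_fin.
- by apply: oc_mass_fin; exact: lt_le_trans xy.
rewrite -measureU//; first by rewrite -itv_bndbnd_setU// bnd_simp.
rewrite -subset0 => w [] /=; rewrite !in_itv/= => /andP[_ zN] /andP[Nz _].
by move: (lt_le_trans Nz zN); rewrite ltxx.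
Qed.

Lemma oc_mass_le m a b x y : 0 < a -> a <= x -> y <= b ->
  oc_mass m x y <= fine (m `[a, b]%classic).
Proof.
move=> a0 ax yb; apply: fine_le.
- by apply: oc_mass_fin; exact: lt_le_trans ax.
- exact: (@radon_fin_num _ m a b).
- apply: le_measure; rewrite ?inE// => z /=; rewrite !in_itv/= => /andP[xz zy].
  by rewrite (le_trans ax (ltW xz)) (le_trans zy).
Qed.

(** The distribution function on the logarithmic scale, normalised to vanish at
    0; one of the two intervals is always empty. *)
Definition log_distr m y : R := oc_mass m 1 (expR y) - oc_mass m (expR y) 1.

Lemma log_distrB m x y : x <= y ->
  log_distr m y - log_distr m x = oc_mass m (expR x) (expR y).
Proof.
move=> xy; have exy : expR x <= expR y by rewrite ler_expR.
rewrite /log_distr; have [x1|/ltW x1] := leP 1 (expR x).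
  have y1 := le_trans x1 exy.
  rewrite (oc_mass0 m y1) (oc_mass0 m x1) !subr0.
  by rewrite (@oc_massD m 1 (expR x) (expR y))// addrC addKr.
rewrite (oc_mass0 m x1) sub0r opprK.
have [y1|/ltW y1] := leP 1 (expR y).
  rewrite (oc_mass0 m y1) subr0 (@oc_massD m (expR x) 1 (expR y)) ?expR_gt0//.
  by rewrite addrC.
rewrite (oc_mass0 m y1) sub0r (@oc_massD m (expR x) (expR y) 1) ?expR_gt0//.
by rewrite addrC addrK.
Qed.

Lemma log_distr_bound m y :
  `|log_distr m y| <= fine (m `[expR (- `|y|), expR `|y|]%classic).
Proof.
have e1 : 1 <= expR `|y| by rewrite -expR0 ler_expR.
have e2 : expR (- `|y|) <= 1 by rewrite -[leRHS]expR0 ler_expR oppr_le0.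
have ey1 : expR y <= expR `|y| by rewrite ler_expR ler_norm.
have ey2 : expR (- `|y|) <= expR y by rewrite ler_expR lerNl -normrN ler_norm.
rewrite /log_distr; have [y1|/ltW y1] := leP 1 (expR y).
  by rewrite (oc_mass0 m y1) subr0 ger0_norm ?oc_mass_ge0// oc_mass_le ?expR_gt0.
rewrite (oc_mass0 m y1) sub0r normrN ger0_norm ?oc_mass_ge0//.
by rewrite oc_mass_le ?expR_gt0.
Qed.

(** [G x] is the infimum of [F] on the points beyond [x]. *)
Lemma right_regularize (F : R -> R) : {homo F : x y / x <= y} ->
  exists G : R -> R, [/\ {homo G : x y / x <= y}, right_continuous G,
    forall x, F x <= G x & forall x y, x < y -> G x <= F y].
Proof.
move=> ndF; pose S x := F @` `]x, +oo[; pose G x := inf (S x).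
have Sn0 x : S x !=set0.
  by exists (F (x + 1)), (x + 1) => //=; rewrite in_itv/= andbT ltrDl.
have Slb x : lbound (S x) (F x).
  by move=> _ [y /= + <-]; rewrite in_itv/= andbT => /ltW; exact: ndF.
have FG x : F x <= G x by exact: lb_le_inf.
have GF x y : x < y -> G x <= F y.
  move=> xy; apply: ge_inf; first by exists (F x).
  by exists y => //=; rewrite in_itv/= andbT.
have ndG : {homo G : x y / x <= y}.
  move=> x y xy; apply: lb_le_inf => // _ [z /= + <-].
  by rewrite in_itv/= andbT => yz; apply: GF; exact: le_lt_trans yz.
exists G; split=> //; move=> x; apply/cvgrPdist_le => e e0.
have [_ [z /= + <-] Fz] := inf_adherent e0 (conj (Sn0 x) (ex_intro _ _ (Slb x))).
rewrite in_itv/= andbT => xz; near=> y.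
have xy : x < y by near: y; exact: nbhs_right_gt.
have yz : y < z by near: y; exact: nbhs_right_lt.
rewrite distrC ger0_norm ?subr_ge0 ?ndG ?(ltW xy)//.
by rewrite lerBlDl (le_trans (GF _ _ yz))// ltW.
Unshelve. all: by end_near. Qed.

Lemma log_Riemann_sum m a b f w (y : nat -> R) N : test_on a b f ->
    (forall i, y i <= y i.+1) -> expR (y 0%N) < a -> b <= expR (y N) ->
    (forall i z, (i < N)%N -> y i < z <= y i.+1 ->
       `|f (expR z) - f (expR (y i))| <= w) ->
  `|mint m f - \sum_(i < N) f (expR (y i)) * (log_distr m (y i.+1) - log_distr m (y i))|
    <= w * (log_distr m (y N) - log_distr m (y 0%N)).
Proof.
move=> tf yS y0 yN fw.
have ym : y 0%N <= y N by elim: (N) => // k /le_trans; exact.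
have sub : `[a, b] `<=` `]expR (y 0%N), expR (y N)].
  move=> z /=; rewrite !in_itv/= => /andP[az zb].
  by rewrite (lt_le_trans y0)// (le_trans zb).
rewrite /mint (@Rintegral_test _ m a b f `]expR (y 0%N), expR (y N)]%classic)//.
  rewrite log_distrB// (eq_bigr (fun i : 'I_N => f (expR (y i)) *
    fine (m `]expR (y i), expR (y i.+1)]%classic))); last first.
    by move=> i _; rewrite log_distrB.
  apply: (@Riemann_sum _ m a b f w (expR \o y)) => //=.
  - exact: expR_gt0.
  - by move=> i; rewrite ler_expR.
  - move=> i z iN; have [z0|z0] := ltP 0 z.
      by rewrite -{1 2 3}(lnK z0) ltr_expR ler_expR; exact: fw.
    by move=> /andP[/(lt_trans (expR_gt0 _))]; rewrite ltNge z0.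
move=> z /=; rewrite !in_itv/= andbT => /andP[+ _]; apply: lt_trans.
exact: expR_gt0.
Qed.

(** Along an ultrafilter the bounded distribution functions converge at every
    point, to a monotone [F].  The limit measure is the one of the
    right-continuous regularisation [G].  An integral against [m n], a Stieltjes
    sum of [m n], the same sum of [F], of [G], and the integral against the limit
    measure are successively close, uniformly in [n]. *)
Theorem helly_ultra (T : Type) (U : set_system T) (m : T -> pos_radon R) :
    UltraFilter U ->
    (forall a b, 0 < a -> exists M, U [set n | fine (m n `[a, b]%classic) <= M]) ->
  exists m0 : pos_radon R, forall a b f, test_on a b f ->
    mint (m n) f @[n --> U] --> mint m0 f.
Proof.
move=> UU bnd.
have /choice[F FE] : forall y, exists l : R, log_distr (m n) y @[n --> U] --> l.
  move=> y; have [M HM] := bnd (expR (- `|y|)) (expR `|y|) (expR_gt0 _).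
  apply: (@ultra_bounded_cvg _ _ U _ M); apply: (@filterS T U) HM => n /=.
  by apply: le_trans; exact: log_distr_bound.
have ndF : {homo F : x y / x <= y}.
  move=> x y xy; rewrite -subr_ge0.
  have /cvgr_to_ge : log_distr (m n) y - log_distr (m n) x @[n --> U] --> F y - F x.
    by apply: cvgB.
  by apply; apply: nearW => n; rewrite log_distrB ?oc_mass_ge0.
have [G [ndG rcG FG GF]] := right_regularize ndF.
have [m0 m0E] := stieltjes_pos_radon ndG rcG.
exists m0 => a b f tf.
have GE x y : x <= y -> log_distr m0 y - log_distr m0 x = G y - G x.
  by move=> xy; rewrite log_distrB// /oc_mass m0E.
have [a0 cf f0] := tf.
pose g z := f (expR z).
have cg : continuous g.
  by move=> z; apply: continuous_comp; [exact: continuous_expR|exact: cf].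
pose al := ln a - 1; pose be := `|ln a| + `|ln b| + 1.
have eal : expR al < a by rewrite -[ltRHS](lnK a0) ltr_expR /al gtrBl.
have ebe : a <= b -> b < expR be.
  move=> ab; have b0 : 0 < b by exact: lt_le_trans ab.
  rewrite -[ltLHS](lnK b0) ltr_expR /be; have := ler_norm (ln b).
  by have := normr_ge0 (ln a); lra.
have albe : al < be.
  rewrite /al /be; have := ler_norm (ln a); have := normr_ge0 (ln b); lra.
have g0 z : ~ (al <= z <= be) -> g z = 0.
  move=> nz; rewrite /g f0// => /andP[az zb]; apply: nz; apply/andP; split.
    by rewrite -ler_expR (le_trans (ltW eal)).
  by rewrite -ler_expR (le_trans zb)// ltW// ebe// (le_trans az).
(* The errors below are [w] times [F be - F al + 1] (integral against [m n]),
   [w] (convergence of the sums), and twice [w * (G be - G al)] (passage from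
   [F] to [G], integral against [m0]). *)
pose K := F be - F al + 1 + 2 * (G be - G al) + 1.
have K0 : 0 < K.
  rewrite /K; have := ndF _ _ (ltW albe); have := ndG _ _ (ltW albe).
  by move=> ? ?; lra.
apply/cvgrPdist_le => e e0.
pose w := e / 2 / K; have w0 : 0 < w by rewrite !divr_gt0.
have [h h0 gw] := compactly_supported_unif cg g0 w0.
pose N := (Num.truncn ((be - al) / h)).+1.
have N0 : 0 < N%:R :> R by rewrite ltr0n.
pose s := (be - al) / N%:R.
have s0 : 0 < s by rewrite divr_gt0 ?subr_gt0.
have sh : s < h.
  rewrite /s ltr_pdivrMr// mulrC -ltr_pdivrMr//; exact: truncnS_gt.
pose y (i : nat) := al + i%:R * s.
have yS i : y i.+1 = y i + s by rewrite /y -natr1; ring.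
have yle i : y i <= y i.+1 by rewrite yS lerDl ltW.
have ylt i : y i < y i.+1 by rewrite yS ltrDl.
have y0 : y 0%N = al by rewrite /y mul0r addr0.
have yN : y N = be by rewrite /y /s mulrCA mulfV ?gt_eqF// mulr1 addrC subrK.
have osc i z : (i < N)%N -> y i < z <= y i.+1 -> `|g z - g (y i)| <= w.
  move=> _ /andP[yz zy]; apply: gw; rewrite ger0_norm ?subr_ge0 ?ltW//.
  by rewrite yS in zy; lra.
have RS mm : `|mint mm f -
    \sum_(i < N) g (y i) * (log_distr mm (y i.+1) - log_distr mm (y i))|
    <= w * (log_distr mm be - log_distr mm al).
  have [ab|ba] := leP a b; last first.
    have fz z : f z = 0 by apply: f0; lra.
    have -> : mint mm f = 0.
      by rewrite /mint /Rintegral integral0_eq// => z _; rewrite fz.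
    rewrite big1 => [|i _]; last by rewrite /g fz mul0r.
    by rewrite subrr normr0 mulr_ge0 ?(ltW w0)// log_distrB ?(ltW albe)// oc_mass_ge0.
  by rewrite -y0 -yN; apply: log_Riemann_sum tf _ _ _ osc;
    rewrite ?y0 ?yN// ltW// ebe.
have g00 : g (y 0%N) = 0.
  by rewrite y0 /g f0// => /andP[ae _]; move: eal; rewrite ltNge ae.
have gN0 : g (y N) = 0.
  rewrite yN /g f0// => /andP[ae eb]; have := ebe (le_trans ae eb).
  by rewrite ltNge eb.
have cS : \sum_(i < N) g (y i) * (log_distr (m n) (y i.+1) - log_distr (m n) (y i))
   @[n --> U] --> \sum_(i < N) g (y i) * (F (y i.+1) - F (y i)).
  apply: (@cvg_big _ _ +%R) => // [|i _]; first exact: add_continuous.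
  by apply: cvgM; [exact: cvg_cst|exact: cvgB].
have cK : log_distr (m n) be - log_distr (m n) al @[n --> U] --> F be - F al.
  exact: cvgB.
have P := @Stieltjes_sum_perturb _ (g \o y) (F \o y) (G \o y) w N g00 gN0.
have {}P : `|\sum_(i < N) g (y i) * (F (y i.+1) - F (y i)) -
    \sum_(i < N) g (y i) * (G (y i.+1) - G (y i))| <= w * (G be - G al).
  rewrite -y0 -yN; apply: P => i.
  - by move=> _; apply: gw; rewrite yS addrAC subrr add0r gtr0_norm.
  - exact: FG.
  - exact: GF.
have R0 : `|mint m0 f - \sum_(i < N) g (y i) * (G (y i.+1) - G (y i))|
    <= w * (G be - G al).
  rewrite -GE ?(ltW albe)//; apply: le_trans (RS m0).
  by under [in leRHS]eq_bigr do rewrite GE//.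
have wK : w * K = e / 2 by rewrite /w mulfVK// gt_eqF.
move/cvgrPdist_le : cS => /(_ _ w0) cS.
move/cvgrPdist_le : cK => /(_ _ ltr01) cK.
near=> n.
have Rn := RS (m n).
have Sn : `|\sum_(i < N) g (y i) * (F (y i.+1) - F (y i)) -
   \sum_(i < N) g (y i) * (log_distr (m n) (y i.+1) - log_distr (m n) (y i))| <= w.
  by near: n; exact: cS.
have Kn : log_distr (m n) be - log_distr (m n) al <= F be - F al + 1.
  have : `|F be - F al - (log_distr (m n) be - log_distr (m n) al)| <= 1.
    by near: n; exact: cK.
  by rewrite ler_norml => /andP[+ _]; lra.
have wKn := ler_wpM2l (ltW w0) Kn.
have {}wK : w * (F be - F al + 1) + w * (G be - G al) + w * (G be - G al) + w = e / 2.
  by rewrite -wK /K; ring.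
move: Rn R0 Sn P wKn wK e0.
set A := \sum_(i < N) _; set B := \sum_(i < N) _; set C := \sum_(i < N) _.
rewrite distrC => Rn R0 Sn P wKn wK e0.
have t1 := ler_normD (mint m0 f - B) (B - mint (m n) f).
have t2 := ler_normD (B - C) (C - mint (m n) f).
have t3 := ler_normD (C - A) (A - mint (m n) f).
rewrite !subrKA in t1 t2 t3; rewrite distrC in P.
by move: t1 t2 t3 Rn R0 Sn P wKn wK e0; clear; move=> *; lra.
Unshelve. all: by end_near. Qed.

End helly_theorem.

(** * Jordan decomposition of a difference of Radon measures *)

Section jordan.
Context {R : realType}.
Local Notation TR := (measurableTypeR R).
Implicit Types (m : pos_radon R) (a b x y : R).

Lemma finite_jordan (m1 m2 : {finite_measure set TR -> \bar R}) :
  exists (p q : {measure set TR -> \bar R}) (P : set TR),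
  [/\ measurable P, q P = 0%E, p (~` P) = 0%E &
    forall A, measurable A ->
      [/\ (p A <= m1 A)%E, (q A <= m2 A)%E & (m1 A + q A = m2 A + p A)%E]].
Proof.
pose nu : {charge set TR -> \bar R} :=
  cadd (charge_of_finite_measure m1) (copp (charge_of_finite_measure m2)).
have [P [N nuPN]] := Hahn_decomposition nu.
have [[mP posP] [mN negN] PNT PN0] := nuPN.
have nuE A : nu A = (m1 A - m2 A)%E by [].
have pE A : measurable A -> jordan_pos nuPN A = (m1 (A `&` P) - m2 (A `&` P))%E.
  by move=> mA; rewrite jordan_posE cjordan_posE /crestr0 mem_set.
have qE A : measurable A -> jordan_neg nuPN A = (m2 (A `&` N) - m1 (A `&` N))%E.
  move=> mA; rewrite jordan_negE cjordan_negE /crestr0 mem_set// /crestr nuE.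
  rewrite oppeD ?oppeK 1?addeC//.
  by rewrite fin_num_adde_defl// fin_numN fin_num_measure//; exact: measurableI.
have fin (m : {finite_measure set TR -> \bar R}) A : measurable A -> m A \is a fin_num.
  by move=> mA; rewrite fin_num_measure.
exists (jordan_pos nuPN), (jordan_neg nuPN), P; split => //.
- by apply: etrans (qE _ mP) _; rewrite PN0 !measure0 sube0.
- apply: etrans (pE _ (measurableC mP)) _.
  by rewrite setICl !measure0 sube0.
move=> A mA; split.
- rewrite [leLHS](pE _ mA) (@le_trans _ _ (m1 (A `&` P)))//.
    rewrite leeBlDr ?fin//; last exact: measurableI.
    by rewrite leeDl.
  by apply: le_measure; rewrite ?inE//; exact: measurableI.
- rewrite [leLHS](qE _ mA) (@le_trans _ _ (m2 (A `&` N)))//.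
    rewrite leeBlDr ?fin//; last exact: measurableI.
    by rewrite leeDl.
  by apply: le_measure; rewrite ?inE//; exact: measurableI.
have : (m1 A - m2 A = jordan_pos nuPN A - jordan_neg nuPN A)%E.
  by rewrite -nuE (jordan_decomp nuPN mA) /cadd/= cscaleN1.
move=> H0.
suff : (m1 A + jordan_neg nuPN A = m2 A + jordan_pos nuPN A)%E by [].
have p1 : jordan_pos nuPN A \is a fin_num by rewrite fin_num_measure.
have p2 : jordan_neg nuPN A \is a fin_num by rewrite fin_num_measure.
have p3 := fin m1 A mA; have p4 := fin m2 A mA.
move: H0 p1 p2 p3 p4 => + p1 p2 p3 p4; move: p1 p2 p3 p4.
move: (jordan_pos nuPN A) (jordan_neg nuPN A) (m1 A) (m2 A).
by move=> [p||] [q||] [u||] [v||]//= _ _ _ _ [H]; congr EFin; lra.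
Qed.

(** A partition of the half-line into countably many relatively compact pieces:
    the difference of two Radon measures is a finite charge on each of them. *)
Definition shell (n : nat) : set R := seqD (fun k => `[k.+1%:R^-1, k.+1%:R]%classic) n.

Lemma shell_sub n : shell n `<=` `[n.+1%:R^-1, n.+1%:R].
Proof. by case: n => [//|n]; exact: subDsetl. Qed.

Lemma measurable_shell n : measurable (shell n : set TR).
Proof. by rewrite /shell; case: n => [|n] /=; [|apply: measurableD]. Qed.

Lemma trivIset_shell : trivIset setT shell.
Proof.
apply: trivIset_seqD => n k nk; apply/subsetPset => x /=.
rewrite !in_itv/= => /andP[xn nx]; apply/andP; split.
  by apply: le_trans xn; rewrite lef_pV2 ?posrE ?ltr0n// ler_nat.
by rewrite (le_trans nx)// ler_nat.
Qed.

Lemma bigcup_shell : \bigcup_n shell n = `]0, +oo[%classic.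
Proof.
rewrite eq_bigcup_seqD; apply/seteqP; split => x /=.
  move=> [n _ /=]; rewrite !in_itv/= andbT => /andP[+ _]; apply: lt_le_trans.
  by rewrite invr_gt0 ltr0n.
rewrite in_itv/= andbT => x0; pose n := maxn (Num.truncn x) (Num.truncn x^-1).
have n1 : x <= n.+1%:R.
  by rewrite ltW// (lt_le_trans (truncnS_gt _))// ler_nat ltnS leq_maxl.
have n2 : x^-1 <= n.+1%:R.
  by rewrite ltW// (lt_le_trans (truncnS_gt _))// ler_nat ltnS leq_maxr.
exists n => //=; rewrite in_itv/= n1 andbT.
by rewrite -[leRHS]invrK lef_pV2 ?posrE ?invr_gt0 ?ltr0n.
Qed.

Lemma radon_shell_sum m (A : set TR) : measurable A ->
  m A = (\sum_(n <oo) m (A `&` shell n))%E.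
Proof.
move=> mA.
have mS n : measurable (A `&` shell n : set TR).
  by apply: measurableI => //; exact: measurable_shell.
have -> : m A = m (A `&` `]0, +oo[).
  rewrite -[in LHS](setIT A) -(setUv `]0, +oo[%classic) setIUr measureU//.
  - rewrite [X in (_ + X)%E](_ : _ = 0%E) ?adde0//.
    apply/eqP; rewrite eq_le measure_ge0 andbT -[leRHS](pos_radon_out m).
    apply: le_measure; rewrite ?inE//; last exact: measurableC.
    by apply: measurableI => //; exact: measurableC.
  - exact: measurableI.
  - by apply: measurableI => //; exact: measurableC.
  - by rewrite setIACA setICr setI0.
rewrite -bigcup_shell setI_bigcupr measure_bigcup//.
  by apply: eq_eseriesl => n; rewrite in_setT.
exact: trivIset_setIl trivIset_shell.
Qed.

(** Hahn's theorem applies on each shell; the sums over the shells of the local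
    positive and negative parts are carried by complementary sets and are
    dominated by [m1] and [m2], hence Radon.  The conclusion is an equality of
    sums because [m1 - m2] makes no sense on sets of infinite mass. *)
Lemma jordan_radon (m1 m2 : pos_radon R) : exists r : real_radon R,
  forall A : set TR, measurable A -> (m1 A + rneg r A = m2 A + rpos r A)%E.
Proof.
have fin m n : (m (shell n) < +oo)%E.
  apply: (@radon_finite_sub _ m n.+1%:R^-1 n.+1%:R) (@shell_sub n).
    by rewrite invr_gt0 ltr0n.
  exact: measurable_shell.
pose res m n : {finite_measure set TR -> \bar R} :=
  mfrestr (measurable_shell n) (fin m n).
have resE m n A : res m n A = m (A `&` shell n) by [].
have /choice[p /choice[q /choice[P H]]] :=
  fun n => finite_jordan (res m1 n) (res m2 n).
pose ps : {measure set TR -> \bar R} := mseries p 0.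
pose qs : {measure set TR -> \bar R} := mseries q 0.
pose Ps : set TR := \bigcup_n (P n `&` shell n).
have mP n : measurable (P n) by case: (H n).
have mPs : measurable Ps.
  by apply: bigcup_measurable => n _; apply: measurableI => //; exact: measurable_shell.
have mC n : measurable (~` shell n : set TR).
  by apply: measurableC; exact: measurable_shell.
have PsE n x : shell n x -> Ps x -> P n x.
  move=> nx [k _ [Pkx kx]]; suff -> : n = k by [].
  by apply: (trivIset_shell (i := n) (j := k)) => //; exists x.
have ple A : measurable A -> (ps A <= m1 A)%E.
  move=> mA; rewrite (radon_shell_sum m1 mA); apply: lee_nneseries => // n _.
  by have [_ _ _ /(_ _ mA)[]] := H n.
have qle A : measurable A -> (qs A <= m2 A)%E.
  move=> mA; rewrite (radon_shell_sum m2 mA); apply: lee_nneseries => // n _.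
  by have [_ _ _ /(_ _ mA)[]] := H n.
have sumE A : measurable A -> (m1 A + qs A = m2 A + ps A)%E.
  move=> mA; rewrite (radon_shell_sum m1 mA) (radon_shell_sum m2 mA).
  rewrite /ps /qs /= /mseries -!nneseriesD//; apply: eq_eseriesr => n _.
  by have [_ _ _ /(_ _ mA)[]] := H n.
have qs0 : qs Ps = 0%E.
  rewrite /qs /= /mseries eseries0// => n _ _.
  have [_ qP _ Hn] := H n; have [_ qle' _] := Hn _ (mC n).
  apply/eqP; rewrite eq_le measure_ge0 andbT.
  apply: (@le_trans _ _ (q n (P n `|` ~` shell n))).
    apply: le_measure; rewrite ?inE//; first exact: measurableU.
    by move=> x Px; have [nx|] := pselect (shell n x); [left; exact: (PsE n)|right].
  apply: le_trans (measureU2 _ _ _) _ => //.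
  rewrite [X in (X + _)%E]qP add0e (le_trans qle')// resE setICl.
  by rewrite measure0.
have ps0 : ps (~` Ps) = 0%E.
  rewrite /ps /= /mseries eseries0// => n _ _.
  have [_ _ pP Hn] := H n; have [ple' _ _] := Hn _ (mC n).
  have mCP : measurable (~` P n) by exact: measurableC.
  apply/eqP; rewrite eq_le measure_ge0 andbT.
  apply: (@le_trans _ _ (p n (~` P n `|` ~` shell n))).
    apply: le_measure; rewrite ?inE//; [exact: measurableC|exact: measurableU|].
    move=> x Px; have [nx|] := pselect (shell n x); [left|by right].
    by move=> Pnx; apply: Px; exists n.
  apply: le_trans (measureU2 _ _ _) _ => //.
  rewrite [X in (X + _)%E]pP add0e (le_trans ple')// resE setICl.
  by rewrite measure0.
have out m (nu : {measure set TR -> \bar R}) :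
    (forall A, measurable A -> (nu A <= m A)%E) -> nu (~` `]0, +oo[%classic) = 0%E.
  move=> le; apply/eqP; rewrite eq_le measure_ge0 andbT -(pos_radon_out m).
  by apply: le; exact: measurableC.
have [|a b a0|pr prE] := @pos_radon_of_measure _ ps; first exact: out ple.
  by rewrite (le_lt_trans (ple _ _))//; exact: radon_finite.
have [|a b a0|qr qrE] := @pos_radon_of_measure _ qs; first exact: out qle.
  by rewrite (le_lt_trans (qle _ _))//; exact: radon_finite.
have sing : mutually_singular pr qr.
  exists (~` Ps); split; first exact: measurableC.
    by rewrite prE//; exact: measurableC.
  by rewrite setCK qrE.
by exists (RealRadon sing) => A mA /=; rewrite prE// qrE// sumE.
Qed.

Lemma jordan_integral (m1 m2 : pos_radon R) : exists r : real_radon R,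
  forall a b f, test_on a b f -> real_integral r f = mint m1 f - mint m2 f.
Proof.
have [r rE] := jordan_radon m1 m2; exists r => a b f tf.
have I0 (m : pos_radon R) := test_integrable m tf.
have moo : measurable (`]0, +oo[%classic : set TR) by [].
pose II (m : pos_radon R) :=
  (\int[m]_(x in (`]0%R, +oo[%classic : set TR)) (EFin \o f) x)%E.
have E : (II m1 + II (rneg r) = II m2 + II (rpos r))%E.
  rewrite -(integral_measure_add moo (I0 m1) (I0 (rneg r))).
  rewrite -(integral_measure_add moo (I0 m2) (I0 (rpos r))).
  apply: eq_measure_integral => A mA _.
  apply: etrans (measure_addE _ _ _) _; apply: etrans _ (esym (measure_addE _ _ _)).
  exact: rE.
have F (m : pos_radon R) : II m \is a fin_num := integrable_fin_num moo (I0 m).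
have -> : real_integral r f = fine (II (rpos r)) - fine (II (rneg r)) by [].
have -> : mint m1 f - mint m2 f = fine (II m1) - fine (II m2) by [].
move: E (F m1) (F m2) (F (rneg r)) (F (rpos r)).
move: (II m1) (II m2) (II (rneg r)) (II (rpos r)).
by move=> [p||] [q||] [u||] [v||]//= [H] _ _ _ _; lra.
Qed.

End jordan.

(** * Wide convergence through real test functions *)

Section functionals.
Local Open Scope complex_scope.
Context {R : realType}.
Local Notation TR := (measurableTypeR R).
Implicit Types (m : pos_radon R) (r : real_radon R) (f g : R -> R) (a b c x y : R).

Lemma real_integralE r f : real_integral r f = mint (rpos r) f - mint (rneg r) f.
Proof. by []. Qed.

Lemma real_integralD r a b f g : test_on a b f -> test_on a b g ->
  real_integral r (fun x => f x + g x) = real_integral r f + real_integral r g.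
Proof.
by move=> tf tg; rewrite !real_integralE !(mintD _ tf tg); ring.
Qed.

Lemma real_integralZ r a b c f : test_on a b f ->
  real_integral r (fun x => c * f x) = c * real_integral r f.
Proof. by move=> tf; rewrite !real_integralE !(mintZ _ _ tf); ring. Qed.

Lemma real_integralB r a b f g : test_on a b f -> test_on a b g ->
  real_integral r (fun x => f x - g x) = real_integral r f - real_integral r g.
Proof.
move=> tf tg; rewrite -[X in _ = _ + X]mulN1r -(real_integralZ r (-1) tg).
rewrite -(real_integralD r tf (test_onZ (-1) tg)).
by congr real_integral; apply/funext => x; rewrite mulN1r.
Qed.

Lemma real_integral0 r : real_integral r (fun=> 0) = 0.
Proof.
rewrite -[RHS](mul0r (real_integral r (fun=> 0))).
rewrite -(real_integralZ r 0 (@test_on0 R 1 1 ltr01)).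
by congr real_integral; apply/funext => x; rewrite mul0r.
Qed.

Definition variation_mass r a b : R :=
  fine (rpos r `[a, b]%classic) + fine (rneg r `[a, b]%classic).

Lemma real_integral_bound r a b c f : test_on a b f -> (forall x, `|f x| <= c) ->
  `|real_integral r f| <= c * variation_mass r a b.
Proof.
move=> tf fc; rewrite real_integralE (le_trans (ler_normB _ _))// mulrDr.
by rewrite lerD// mint_bound.
Qed.

Lemma complex_ReB (z w : R[i]) : complex.Re (z - w) = complex.Re z - complex.Re w.
Proof. by case: z w => ? ? []. Qed.

Lemma complex_ImB (z w : R[i]) : complex.Im (z - w) = complex.Im z - complex.Im w.
Proof. by case: z w => ? ? []. Qed.

Lemma normc_le_ReIm (z : R[i]) : Normc.normc z <= `|complex.Re z| + `|complex.Im z|.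
Proof.
case: z => u v /=; rewrite -[leRHS]ger0_norm ?addr_ge0// -sqrtr_sqr ler_sqrt ?sqr_ge0//.
rewrite sqrrD !real_normK ?num_real//.
have : 0 <= `|u| * `|v| by rewrite mulr_ge0.
by rewrite mulr2n; lra.
Qed.

Lemma Re_le_normc (z : R[i]) : `|complex.Re z| <= Normc.normc z.
Proof.
by case: z => u v /=; rewrite -sqrtr_sqr ler_sqrt ?addr_ge0 ?sqr_ge0// lerDl sqr_ge0.
Qed.

Lemma Im_le_normc (z : R[i]) : `|complex.Im z| <= Normc.normc z.
Proof.
by case: z => u v /=; rewrite -sqrtr_sqr ler_sqrt ?addr_ge0 ?sqr_ge0// lerDr sqr_ge0.
Qed.

Lemma normc_normr (z : R[i]) : `|z| = (Normc.normc z)%:C.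
Proof. by case: z => u v; rewrite normc_def. Qed.

Lemma cvg_normcP (T : Type) (F : set_system T) {FF : Filter F} (z : T -> R[i])
    (l : R[i]) :
  z n @[n --> F] --> l <->
  forall e : R, 0 < e -> \forall n \near F, Normc.normc (l - z n) <= e.
Proof.
split=> [/cvgrPdist_le H e e0|H].
  have := H e%:C; rewrite ltcR => /(_ e0); apply: filterS => n.
  by rewrite normc_normr lecR.
apply/cvgrPdist_le => e; rewrite ltcE => /andP[/eqP ei er].
have -> : e = (complex.Re e)%:C by case: e ei er => u v /= ->.
by apply: filterS (H _ er) => n nl; rewrite normc_normr lecR.
Qed.

Lemma cvg_complexP (T : Type) (F : set_system T) {FF : Filter F} (z : T -> R[i])
    (l : R[i]) :
  z n @[n --> F] --> l <->
  complex.Re (z n) @[n --> F] --> complex.Re l /\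
  complex.Im (z n) @[n --> F] --> complex.Im l.
Proof.
split=> [/cvg_normcP H|[/cvgrPdist_le Hr /cvgrPdist_le Hi]].
  split; apply/cvgrPdist_le => e /H; apply: filterS => n; apply: le_trans.
    by rewrite -complex_ReB Re_le_normc.
  by rewrite -complex_ImB Im_le_normc.
apply/cvg_normcP => e e0; have e2 : 0 < e / 2 by rewrite divr_gt0.
near=> n; rewrite (le_trans (normc_le_ReIm _))// complex_ReB complex_ImB.
rewrite [leRHS]splitr lerD//; near: n; [exact: Hr|exact: Hi].
Unshelve. all: by end_near. Qed.

Lemma Phi_test (phi : R -> R[i]) : Phi phi ->
  exists a b, test_on a b (fun x => complex.Re (phi x)) /\
              test_on a b (fun x => complex.Im (phi x)).
Proof.
move=> [cphi [a [b [a0 sphi]]]]; exists a, b; split; split => //.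
- by move=> x; have /cvg_complexP[] := cphi x.
- by move=> x nx; rewrite sphi.
- by move=> x; have /cvg_complexP[] := cphi x.
- by move=> x nx; rewrite sphi.
Qed.

Lemma test_Phi a b f : test_on a b f -> Phi (fun x => (f x)%:C).
Proof.
move=> [a0 cf f0]; split; last by exists a, b; split => // x /f0 ->.
by move=> x; apply/cvg_complexP; split => /=; [exact: cf|exact: cvg_cst].
Qed.

Lemma pairing_real (mu : complex_radon R) f : pairing mu (fun x => (f x)%:C) =
  real_integral (re_radon mu) f +i* real_integral (im_radon mu) f.
Proof. by rewrite /pairing /= !real_integral0 subr0 add0r. Qed.

(** Wide convergence, for an arbitrary filter and tested on real functions. *)
Definition vague (T : Type) (F : set_system T) (mu : T -> complex_radon R)
  (nu : complex_radon R) := forall a b f, test_on a b f ->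
    real_integral (re_radon (mu n)) f @[n --> F] --> real_integral (re_radon nu) f /\
    real_integral (im_radon (mu n)) f @[n --> F] --> real_integral (im_radon nu) f.

Lemma vague_pairing (T : Type) (F : set_system T) {FF : Filter F}
    (mu : T -> complex_radon R) (nu : complex_radon R) : vague F mu nu <->
  forall phi, Phi phi -> pairing (mu n) phi @[n --> F] --> pairing nu phi.
Proof.
split=> [H phi /Phi_test[a [b [tr ti]]]|H a b f tf].
  have [rr ir] := H _ _ _ tr; have [ri ii] := H _ _ _ ti.
  by apply/cvg_complexP; split => /=; [exact: cvgB|exact: cvgD].
have := H _ (test_Phi tf); under eq_cvg do rewrite pairing_real.
by rewrite pairing_real => /cvg_complexP.
Qed.

Lemma wide_cvgP (mu : nat -> complex_radon R) nu : wide_cvg mu nu <-> vague \oo mu nu.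
Proof. by symmetry; exact: vague_pairing. Qed.

End functionals.

(** * Dilations *)

Section dilation.
Local Open Scope complex_scope.
Context {R : realType}.
Local Notation TR := (measurableTypeR R).
Implicit Types (m : pos_radon R) (r : real_radon R) (f g : R -> R) (a b x y : R)
  (c t : {posnum R}).

Lemma test_on_dilate a b t f : test_on a b f ->
  test_on (t%:num * a) (t%:num * b) (fun x => f (t%:num^-1 * x)).
Proof.
move=> [a0 cf f0]; split; first by rewrite mulr_gt0.
  move=> x; apply: (continuous_comp (f := fun x => t%:num^-1 * x)); last exact: cf.
  exact: mulrl_continuous.
move=> x nx; apply: f0 => /andP[ax xb]; apply: nx; apply/andP; split.
  by rewrite -ler_pdivlMl.
by rewrite -ler_pdivrMl.
Qed.

(** The dilated measure is, on Borel sets, the image measure under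
    [x |-> x / t], scaled by [c]. *)
Lemma mint_dilate_ge0 c t m a b f : test_on a b f -> (forall x, 0 <= f x) ->
  mint (pos_dilate c t m) f = c%:num * mint m (fun x => f (t%:num^-1 * x)).
Proof.
move=> tf f0; rewrite /mint.
pose h (x : TR) : TR := t%:num^-1 * x.
pose pm : {measure set TR -> \bar R} := pushforward m h.
have mphi : measurable_fun [set: TR] h by exact: mulrl_measurable.
have mD : measurable (`]0, +oo[%classic : set TR) by [].
have mf : measurable_fun (`]0, +oo[%classic : set TR) (EFin \o f).
  by apply/measurable_EFinP; apply: measurable_funTS; exact: test_measurable tf.
pose D := (`]0, +oo[%classic : set TR).
have E : (\int[pos_dilate c t m]_(x in D) (EFin \o f) x =
    c%:num%:E * \int[m]_(x in D) (f (t%:num^-1 * x)%R)%:E)%E.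
  transitivity (\int[mscale (NngNum (ltW [gt0 of c%:num]))
      (pm mphi)]_(x in D) (EFin \o f) x)%E.
    apply: eq_measure_integral => A mA _ /=.
    by rewrite /pos_dilate_measure scale_setE.
  rewrite ge0_integral_mscale//; last by move=> x _; rewrite lee_fin.
  rewrite /pm.
  rewrite ge0_integral_pushforward//; last by move=> x _; rewrite lee_fin.
  congr (_ * _)%E; rewrite (_ : _ @^-1` D = D)//.
  by apply/seteqP; split=> x; rewrite /D /= !in_itv/= !andbT pmulr_rgt0 ?invr_gt0.
rewrite /Rintegral [X in fine X]E fineM//.
exact: (integrable_fin_num mD (test_integrable m (test_on_dilate t tf))).
Qed.

Lemma mint_dilate c t m a b f : test_on a b f ->
  mint (pos_dilate c t m) f = c%:num * mint m (fun x => f (t%:num^-1 * x)).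
Proof.
move=> tf; pose p x := 2^-1 * (`|f x| + f x); pose n x := 2^-1 * (`|f x| - f x).
have tn : test_on a b (fun x => `|f x|).
  have [a0 cf f0] := tf; split => // x; last by move=> /f0 ->; rewrite normr0.
  by apply: cvg_norm; exact: cf.
have tp : test_on a b p by apply/test_onZ/test_onD.
have tn' : test_on a b n by apply/test_onZ/test_onB.
have p0 x : 0 <= p x by rewrite /p mulr_ge0 ?invr_ge0// -lerBlDr sub0r -normrN ler_norm.
have n0 x : 0 <= n x by rewrite /n mulr_ge0 ?invr_ge0// subr_ge0 ler_norm.
have fE : f = (fun x => p x + (-1) * n x) by apply/funext => x; rewrite /p /n; lra.
rewrite fE (mintD _ tp (test_onZ (-1) tn')) (mintZ _ _ tn').
rewrite (mintD _ (test_on_dilate t tp) (test_onZ (-1) (test_on_dilate t tn'))).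
rewrite (mintZ _ _ (test_on_dilate t tn')).
by rewrite (mint_dilate_ge0 _ _ _ tp)// (mint_dilate_ge0 _ _ _ tn')//; ring.
Qed.

Lemma real_integral_dilate c t r a b f : test_on a b f ->
  real_integral (real_dilate c t r) f =
  c%:num * real_integral r (fun x => f (t%:num^-1 * x)).
Proof. by move=> tf; rewrite !real_integralE /= !(mint_dilate _ _ _ tf) mulrBr. Qed.

Lemma pos_dilate_itv c t m a b : fine (pos_dilate c t m `[a, b]%classic) =
  c%:num * fine (m `[(t%:num * a)%R, (t%:num * b)%R]%classic).
Proof.
rewrite /= /pos_dilate_measure scale_setE.
have -> : (fun x : R => t%:num^-1 * x) @^-1` `[a, b] = `[t%:num * a, t%:num * b]%classic.
  by apply/seteqP; split => x /=; rewrite !in_itv/= ler_pdivlMl// ler_pdivrMl.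
case: (m _) => [y| |]//=; first by rewrite gt0_muley ?lte_fin//= mulr0.
by rewrite gt0_muleNy ?lte_fin//= mulr0.
Qed.

End dilation.

(** * Masses of the Jordan components *)

Section growth_bound.
Local Open Scope complex_scope.
Context {R : realType}.
Local Notation TR := (measurableTypeR R).
Implicit Types (m : pos_radon R) (mu : complex_radon R) (a b x y : R).

(** The two-piece partition of [E] by [B] is one of those in the supremum. *)
Lemma le_total_variation mu (E B : set TR) : measurable E -> rel_compact E ->
  measurable B ->
  ((Normc.normc (complex_val mu (E `&` B)))%:E <= Defs.total_variation mu E)%E.
Proof.
move=> mE [a [b [a0 Eab]]] mB.
pose F := bigcup2 (E `&` B) (E `\` B).
apply: (@le_trans _ _ (\sum_(0 <= k <oo) (Normc.normc (complex_val mu (F k)))%:E)%E).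
  have N0 (z : R[i]) : 0 <= Normc.normc z by case: z => u v; exact: sqrtr_ge0.
  apply: le_trans (nneseries_lim_ge 1%N _); last by move=> *; rewrite lee_fin.
  by rewrite big_nat1.
apply: ereal_sup_ubound; exists F; split.
- by move=> [|[|k]]; [exact: measurableI|exact: measurableD|exact: measurable0].
- move=> k; exists a, b; split => // x Fx; apply: Eab.
  by case: k Fx => [|[|k]] //= [].
- by rewrite -trivIset_bigcup2 setDE setIACA setICr setI0.
- by rewrite bigcup2E setDE -setIUr setUv setIT.
- by [].
Qed.

(** A Jordan component of [mu] on [E] is the value of the real or the imaginary
    part of [mu] on the part of [E] where the opposite component vanishes. *)
Lemma components_le_total_variation mu (E : set TR) : measurable E -> rel_compact E ->
  [/\ (rpos (re_radon mu) E <= Defs.total_variation mu E)%E,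
      (rneg (re_radon mu) E <= Defs.total_variation mu E)%E,
      (rpos (im_radon mu) E <= Defs.total_variation mu E)%E
    & (rneg (im_radon mu) E <= Defs.total_variation mu E)%E].
Proof.
move=> mE rE.
have fin m : m E \is a fin_num.
  by have [a [b [a0 Eab]]] := rE; exact: radon_fin_num Eab.
have part m (P : set TR) : measurable P -> m P = 0%E -> 
   m (E `&` P) = 0%E /\ m (E `&` ~` P) = m E.
  move=> mP mP0; have EP0 : m (E `&` P) = 0%E.
    by apply: subset_measure0 mP0 => //; exact: measurableI.
  split => //; rewrite -[in RHS](setIT E) -(setUv P) setIUr measureU//; last first.
  - by rewrite setIACA setICr setI0.
  - by apply: measurableI => //; exact: measurableC.
  - exact: measurableI.
  by rewrite [X in (X + _)%E]EP0 add0e.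
have key (r : real_radon R) :
    (forall z, `|real_val r z| <= Normc.normc (complex_val mu z)) ->
    (rpos r E <= Defs.total_variation mu E)%E /\
    (rneg r E <= Defs.total_variation mu E)%E.
  move=> rn; have [P [mP pP nP]] := real_radon_sing r.
  have mCP := measurableC mP.
  have [p1 p2] := part _ _ mP pP; have [n1 n2] := part _ _ mCP nP.
  rewrite setCK in n2; split.
    apply: le_trans (le_total_variation mu mE rE mCP).
    rewrite -(fineK (fin _)) lee_fin; apply: le_trans (rn _).
    by rewrite /real_val p2 n1 subr0 ler_norm.
  apply: le_trans (le_total_variation mu mE rE mP).
  rewrite -(fineK (fin _)) lee_fin; apply: le_trans (rn _).
  by rewrite /real_val p1 n2 sub0r normrN ler_norm.
have [z|h1 h2] := key (re_radon mu); first exact: Re_le_normc (complex_val mu z).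
have [z|h3 h4] := key (im_radon mu); first exact: Im_le_normc (complex_val mu z).
by split.
Qed.

Definition growth_bounded (V : R -> R) m := exists2 C, 0 <= C &
  forall r, 1 <= r -> fine (m `[r, expR 1 * r]%classic) <= C * V r.

Lemma Minfty_components rho mu : Minfty rho mu ->
  [/\ growth_bounded (Vord rho) (rpos (re_radon mu)),
      growth_bounded (Vord rho) (rneg (re_radon mu)),
      growth_bounded (Vord rho) (rpos (im_radon mu))
    & growth_bounded (Vord rho) (rneg (im_radon mu))].
Proof.
rewrite /Minfty /=; set S := ereal_sup _ => S1.
have [C C0 SC] : exists2 C : R, 0 <= C & (S <= C%:E)%E.
  case: S S1 => [s _|//|_]; last by exists 0 => //; rewrite leNye.
  by exists `|s| => //; rewrite lee_fin ler_norm.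
pose seg r := `[r, expR 1 * r]%classic : set R.
have tvC r : 1 <= r -> (Defs.total_variation mu (seg r) <= (C * Vord rho r)%:E)%E.
  move=> r1; have V0 : 0 < Vord rho r by rewrite powR_gt0// (lt_le_trans _ r1).
  rewrite EFinM -lee_pdivrMr// (le_trans _ SC)//.
  by apply: ereal_sup_ubound; exists r.
have fin r : 1 <= r -> rel_compact (seg r).
  by move=> r1; exists r, (expR 1 * r); split => //; exact: lt_le_trans r1.
have key m : (forall r, 1 <= r -> (m (seg r) <= Defs.total_variation mu (seg r))%E) ->
    growth_bounded (Vord rho) m.
  move=> H; exists C => // r r1; rewrite -lee_fin fineK; last first.
    by apply: (@radon_fin_num _ m r (expR 1 * r)) => //; exact: lt_le_trans r1.
  exact: le_trans (H _ r1) (tvC _ r1).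
have cp r r1 := @components_le_total_variation mu (seg r)
  (measurable_itv _) (fin r r1).
by split; apply: key => r r1; have [] := cp r r1.
Qed.

(** The growth condition controls segments of ratio [e].  By regular variation
    [V (s x)] is comparable to [V s], which settles the segment from [s x] to
    [e s x]; finitely many of these cover [[s a, s b]], and their number does
    not depend on [s]. *)
Lemma growth_bounded_segment rho m a b : proximate_order rho ->
  growth_bounded (Vord rho) m -> 0 < a ->
  exists M : R, \forall s \near +oo%R,
    fine (m `[s * a, s * b]%classic) / Vord rho s <= M.
Proof.
move=> hrho [C C0 mC] a0.
have base x : 0 < x -> exists M : R, \forall s \near +oo%R,
    fine (m `[s * x, expR 1 * (s * x)]%classic) / Vord rho s <= M.
  move=> x0; have /cvgrPdist_le /(_ _ ltr01) H := Vord_ratio hrho x0.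
  exists (C * (x `^ rho_infty rho + 1)); near=> s.
  have s0 : 0 < s by near: s; exact: nbhs_pinfty_gt.
  have sx : 1 <= s * x.
    by rewrite -ler_pdivrMr//; near: s; exact: nbhs_pinfty_ge (num_real _).
  have V0 : 0 < Vord rho s by rewrite powR_gt0.
  rewrite (@le_trans _ _ (C * (Vord rho (s * x) / Vord rho s)))//.
    by rewrite [leRHS]mulrA ler_pM2r ?invr_gt0// mC.
  rewrite ler_wpM2l//.
  have : `|x `^ rho_infty rho - Vord rho (s * x) / Vord rho s| <= 1.
    by near: s; exact: H.
  by rewrite ler_norml => /andP[+ _]; lra.
have main N : exists M : R, \forall s \near +oo%R,
    fine (m `[s * a, s * (a * expR N%:R)]%classic) / Vord rho s <= M.
  elim: N => [|N [M1 H1]].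
    have [M H] := base a a0; exists M; near=> s.
    have s0 : 0 < s by near: s; exact: nbhs_pinfty_gt.
    have sa0 : 0 < s * a by rewrite mulr_gt0.
    apply: le_trans (_ : _ <= fine (m `[s * a, expR 1 * (s * a)]%classic) / Vord rho s) _.
      rewrite ler_pM2r ?invr_gt0 ?powR_gt0//; apply: fine_le.
      - exact: (@radon_fin_num _ m (s * a) (s * (a * expR 0))).
      - exact: (@radon_fin_num _ m (s * a) (expR 1 * (s * a))).
      - apply: le_measure; rewrite ?inE// expR0 mulr1; apply: subset_itvl.
        by rewrite bnd_simp ler_peMl ?(ltW sa0)// -expR0 ler_expR.
    by near: s; exact: H.
  have [M2 H2] := base (a * expR N%:R) (mulr_gt0 a0 (expR_gt0 _)).
  exists (M1 + M2); near=> s.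
  have s0 : 0 < s by near: s; exact: nbhs_pinfty_gt.
  have sa0 : 0 < s * a by rewrite mulr_gt0.
  have saN0 : 0 < s * (a * expR N%:R) by rewrite !mulr_gt0 ?expR_gt0.
  have A1 : fine (m `[s * a, s * (a * expR N%:R)]%classic) / Vord rho s <= M1 by near: s.
  have A2 : fine (m `[s * (a * expR N%:R), expR 1 * (s * (a * expR N%:R))]%classic)
      / Vord rho s <= M2.
    by near: s.
  apply: le_trans (lerD A1 A2); rewrite -mulrDl ler_pM2r ?invr_gt0 ?powR_gt0//.
  have f1 := @radon_fin_num _ m (s * a) (s * (a * expR N%:R)) _ sa0
    (measurable_itv _) (@subset_refl _ _).
  have f2 := @radon_fin_num _ m _ (expR 1 * (s * (a * expR N%:R))) _ saN0
    (measurable_itv _) (@subset_refl _ _).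
  rewrite -fineD//; apply: fine_le.
  - exact: (@radon_fin_num _ m (s * a) (s * (a * expR N.+1%:R))).
  - by rewrite fin_numD f1 f2.
  apply: le_trans (measureU2 _ _ _) => //; apply: le_measure; rewrite ?inE//.
    exact: measurableU.
  move=> x /=; rewrite !in_itv/= => /andP[ax xb].
  have [xN|/ltW xN] := leP x (s * (a * expR N%:R)); [left|right].
    by rewrite /= ?in_itv/= ax.
  rewrite /= ?in_itv/= xN/= (le_trans xb)// -natr1 expRD.
  by rewrite le_eqVlt; apply/orP; left; apply/eqP; ring.
pose N := (Num.truncn (b / a)).+1.
have [M H] := main N; exists M; near=> s.
have s0 : 0 < s by near: s; exact: nbhs_pinfty_gt.
have sa0 : 0 < s * a by rewrite mulr_gt0.
apply: le_trans (_ : _ <= fine (m `[s * a, s * (a * expR N%:R)]%classic) / Vord rho s) _.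
  rewrite ler_pM2r ?invr_gt0 ?powR_gt0//; apply: fine_le.
  - exact: (@radon_fin_num _ m (s * a) (s * b)).
  - exact: (@radon_fin_num _ m (s * a) (s * (a * expR N%:R))).
  - apply: le_measure; rewrite ?inE//; apply: subset_itvl.
    rewrite bnd_simp ler_pM2l// mulrC -ler_pdivrMr//.
    apply: (@le_trans _ _ N%:R); first by rewrite ltW// truncnS_gt.
    by apply: le_trans (expR_ge1Dx _); rewrite lerDr.
by near: s.
Unshelve. all: by end_near. Qed.

End growth_bound.

(** * A countable determining family of test functions *)

Section tents.
Context {R : realType}.
Implicit Types (r : real_radon R) (f g : R -> R) (a b c x y z : R).

(** The positive part of [1 - |x|]; the formula makes continuity immediate. *)
Definition tent x : R := (`|1 - `|x| | + (1 - `|x|)) / 2.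

Lemma tent_ge0 x : 0 <= tent x.
Proof. by rewrite /tent; have := ler_norm (- (1 - `|x|)); rewrite normrN => ?; lra. Qed.

Lemma tent_out x : 1 <= `|x| -> tent x = 0.
Proof. by rewrite /tent => x1; rewrite ler0_norm; lra. Qed.

(** The integer translates of the tent form a partition of unity.  The proof is
    by induction on the closed form of the sum, which is the truncation of
    [K - z] to the unit interval. *)
Lemma sum_tents K z : 0 <= z -> z + 1 <= K%:R -> \sum_(k < K) tent (z - k%:R) = 1.
Proof.
move=> z0.
have H : \sum_(k < K) tent (z - k%:R) = (`|K%:R - z| - `|K%:R - z - 1| + 1) / 2.
  elim: K => [|K IH].
    by rewrite big_ord0 sub0r normrN (ger0_norm z0) ler0_norm; lra.
  rewrite big_ord_recr/= IH -[K.+1%:R]natr1 /tent.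
  rewrite (distrC z) (_ : K%:R + 1 - z = K%:R - z + 1); last by ring.
  move: (K%:R - z) => v; rewrite (_ : v + 1 - 1 = v); last by ring.
  have [v0|v0] := leP 0 v; have [v1|v1] := leP 0 (v - 1); have [v2|v2] := leP 0 (v + 1);
  rewrite ?(ger0_norm v0) ?(ltr0_norm v0) ?(ger0_norm v1) ?(ltr0_norm v1)
   ?(ger0_norm v2) ?(ltr0_norm v2); try lra.
  - by rewrite ler0_norm; lra.
  - by rewrite ger0_norm; lra.
  - by rewrite ger0_norm; lra.
  - by rewrite ler0_norm; lra.
by move=> zK; rewrite H !ger0_norm; lra.
Qed.

Lemma continuous_tent : continuous tent.
Proof.
have c : continuous (fun x : R => 1 - `|x|).
  by move=> x; apply: cvgB; [exact: cvg_cst|exact: norm_continuous].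
move=> x; apply: cvgM; last exact: cvg_cst.
by apply: cvgD; [apply: cvg_norm; exact: c|exact: c].
Qed.

Definition dyadic_tent (n k : nat) x : R := tent (2 ^+ n * x - k%:R).

Lemma dyadic_tent_out n k x :
  (2 ^+ n)^-1 <= `|x - k%:R / 2 ^+ n| -> dyadic_tent n k x = 0.
Proof.
move=> H; apply: tent_out; have n0 : 0 < 2 ^+ n :> R by rewrite exprn_gt0.
have -> : 2 ^+ n * x - k%:R = 2 ^+ n * (x - k%:R / 2 ^+ n).
  by rewrite mulrBr mulrCA mulfV ?gt_eqF// mulr1.
by rewrite normrM gtr0_norm// -ler_pdivrMl// mulr1.
Qed.

Lemma test_dyadic_tent n k a b : 0 < a -> a <= k%:R / 2 ^+ n - (2 ^+ n)^-1 ->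
  k%:R / 2 ^+ n + (2 ^+ n)^-1 <= b -> test_on a b (dyadic_tent n k).
Proof.
move=> a0 ak kb; split => // [x|x nx].
  apply: (continuous_comp (f := fun x => 2 ^+ n * x - k%:R)); last exact: continuous_tent.
  by apply: cvgB; [exact: mulrl_continuous|exact: cvg_cst].
apply: dyadic_tent_out; rewrite leNgt ltr_norml; apply/negP => ?; apply: nx; lra.
Qed.

(** Piecewise linear interpolation at the points of a fine dyadic grid. *)
Lemma tent_approx a b f e : test_on a b f -> 0 < e -> exists n K : nat,
  [/\ (2 ^+ n)^-1 <= 1 :> R, (2 ^+ n)^-1 <= a / 2 &
  forall x, `|f x - \sum_(k < K) f (k%:R / 2 ^+ n) * dyadic_tent n k x| <= e].
Proof.
move=> [a0 cf f0] e0; have [h h0 fh] := compactly_supported_unif cf f0 e0.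
pose d := Num.min h (Num.min (a / 2) 1).
have d0 : 0 < d by rewrite !lt_min h0 divr_gt0/=.
pose n := Num.truncn d^-1.
have nd : (2 ^+ n)^-1 < d.
  rewrite -[ltRHS]invrK ltf_pV2 ?posrE ?invr_gt0 ?exprn_gt0//.
  apply: (lt_le_trans (truncnS_gt _)); rewrite -natrX ler_nat; exact: ltn_expl.
move: nd; rewrite !lt_min => /and3P[nh na n1].
have n0 : 0 < 2 ^+ n :> R by rewrite exprn_gt0.
pose K := (Num.truncn (2 ^+ n * (b + 1))).+2.
have Kb : 2 ^+ n * (b + 1) + 1 < K%:R.
  by rewrite /K -[ltRHS]natr1 ltrD2r truncnS_gt.
exists n, K; split; [exact: ltW|exact: ltW|move=> x].
have [xin|xout] := pselect (0 <= 2 ^+ n * x /\ 2 ^+ n * x + 1 <= K%:R).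
  have S1 : \sum_(k < K) dyadic_tent n k x = 1 := sum_tents xin.1 xin.2.
  have -> : f x - \sum_(k < K) f (k%:R / 2 ^+ n) * dyadic_tent n k x =
      \sum_(k < K) (f x - f (k%:R / 2 ^+ n)) * dyadic_tent n k x.
    under [RHS]eq_bigr do rewrite mulrBl.
    by rewrite sumrB -mulr_sumr S1 mulr1.
  have eE : e = \sum_(k < K) e * dyadic_tent n k x by rewrite -mulr_sumr S1 mulr1.
  rewrite [leRHS]eE (le_trans (ler_norm_sum _ _ _))//.
  apply: ler_sum => k _; rewrite normrM.
  rewrite [X in _ * X](ger0_norm (tent_ge0 _)) -/(dyadic_tent n k x).
  have [xk|xk] := leP (2 ^+ n)^-1 `|x - k%:R / 2 ^+ n|.
    by rewrite dyadic_tent_out// !mulr0.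
  by rewrite ler_wpM2r ?tent_ge0// fh// (lt_trans xk).
have fx0 : f x = 0.
  apply: f0 => /andP[ax xb]; apply: xout; split.
    by rewrite mulr_ge0 ?(ltW n0)// (le_trans (ltW a0)).
  apply: le_trans (ltW Kb); rewrite lerD2r ler_pM2l//; lra.
rewrite fx0 sub0r normrN big1 ?normr0 ?(ltW e0)// => k _.
have [xk|xk] := leP (2 ^+ n)^-1 `|x - k%:R / 2 ^+ n|.
  by rewrite dyadic_tent_out// mulr0.
rewrite f0 ?mul0r// => /andP[ak kb]; apply: xout.
move: xk; rewrite ltr_norml => /andP[x1 x2].
have x0 : 0 <= x by lra.
split; first by rewrite mulr_ge0// ltW.
apply: le_trans (ltW Kb); rewrite lerD2r ler_pM2l//; lra.
Qed.

(** The shift by 2 keeps the tents whose support is a compact subset of the open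
    half-line. *)
Definition tests (i : nat) : R -> R :=
  if unpickle i is Some (n, k) then dyadic_tent n k.+2 else fun=> 0.

Lemma testsP i : exists a b, test_on a b (tests i).
Proof.
rewrite /tests; case: (unpickle i) => [[n k]|]; last by exists 1, 1; exact: test_on0.
have n0 : 0 < (2 ^+ n)^-1 :> R by rewrite invr_gt0 exprn_gt0.
exists (k.+1%:R / 2 ^+ n), (k.+3%:R / 2 ^+ n); apply: test_dyadic_tent.
- by rewrite mulr_gt0.
- by rewrite -[k.+2%:R]natr1; lra.
- by rewrite -[k.+3%:R]natr1; lra.
Qed.

(** Stated for the functionals and not for the masses, because this form passes
    to limits: a wide limit inherits the bound without any comparison of its
    Jordan components with those of the approximating measures. *)
Definition uniformly_bounded (T : Type) (F : set_system T) (r : T -> real_radon R) :=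
  forall a b, 0 < a -> exists M : R, \forall n \near F, forall f c,
    test_on a b f -> (forall x, `|f x| <= c) -> `|real_integral (r n) f| <= c * M.

Lemma real_integral_sum r a b K (f : nat -> R -> R) :
  0 < a -> (forall k, (k < K)%N -> test_on a b (f k)) ->
  test_on a b (fun x => \sum_(k < K) f k x) /\
  real_integral r (fun x => \sum_(k < K) f k x) = \sum_(k < K) real_integral r (f k).
Proof.
move=> a0; elim: K => [|K IH] H.
  have -> : (fun x => \sum_(k < 0) f k x) = fun=> 0.
    by apply/funext => x; rewrite big_ord0.
  by rewrite big_ord0 real_integral0; split => //; exact: test_on0.
have [|t1 e1] := IH; first by move=> k kK; apply: H; exact: ltnW.
have -> : (fun x => \sum_(k < K.+1) f k x) = fun x => \sum_(k < K) f k x + f K x.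
  by apply/funext => x; rewrite big_ord_recr.
rewrite big_ord_recr/= (real_integralD _ t1 (H _ _))// e1; split => //.
by apply: test_onD t1 _; exact: H.
Qed.

(** The linear span of the tents is dense in the test functions for uniform
    approximation with controlled supports, and the functionals are uniformly
    bounded for this topology. *)
Lemma tests_determine (T : Type) (F : set_system T) {FF : ProperFilter F}
    (r : T -> real_radon R) (r0 : real_radon R) : uniformly_bounded F r ->
    (forall i,
      real_integral (r n) (tests i) @[n --> F] --> real_integral r0 (tests i)) ->
  forall a b f, test_on a b f ->
    real_integral (r n) f @[n --> F] --> real_integral r0 f.
Proof.
move=> bF cF a b f tf; have [a0 cf f0] := tf; apply/cvgrPdist_le => e e0.
have a20 : 0 < a / 2 by rewrite divr_gt0.
have [M HM] := bF (a / 2) (b + 1) a20.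
pose M0 := variation_mass r0 (a / 2) (b + 1).
pose L := `|M| + `|M0| + 1.
have L0 : 0 < L by rewrite ltr_wpDl// addr_ge0.
pose w := e / 2 / L; have w0 : 0 < w by rewrite !divr_gt0.
have [n [K [n1 na fg]]] := tent_approx tf w0.
have n0 : 0 < 2 ^+ n :> R by rewrite exprn_gt0.
have n0' : 0 < (2 ^+ n)^-1 :> R by rewrite invr_gt0.
pose g k x := f (k%:R / 2 ^+ n) * dyadic_tent n k x.
have gz k : ~ (a <= k%:R / 2 ^+ n <= b) -> g k = fun=> 0.
  by move=> nk; apply/funext => x; rewrite /g f0// mul0r.
have tg k : test_on (a / 2) (b + 1) (g k).
  have [/andP[ak kb]|nk] := pselect (a <= k%:R / 2 ^+ n <= b); last first.
    by rewrite (gz _ nk); exact: test_on0.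
  by apply: test_onZ; apply: test_dyadic_tent; lra.
have cg k : real_integral (r n) (g k) @[n --> F] --> real_integral r0 (g k).
  have [/andP[ak kb]|nk] := pselect (a <= k%:R / 2 ^+ n <= b); last first.
    by rewrite (gz _ nk); under eq_cvg do rewrite real_integral0;
      rewrite real_integral0; exact: cvg_cst.
  have td : test_on (a / 2) (b + 1) (dyadic_tent n k) by apply: test_dyadic_tent; lra.
  have k2 : (2 <= k)%N.
    rewrite -(ler_nat R) -(ler_pM2r n0'); lra.
  under eq_cvg do rewrite (real_integralZ _ _ td).
  rewrite (real_integralZ _ _ td); apply: cvgM; first exact: cvg_cst.
  have := cF (pickle (n, (k - 2)%N)); rewrite /tests pickleK.
  by rewrite -[(k - 2).+2]addn2 subnK.
pose G x := \sum_(k < K) g k x.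
have tG : test_on (a / 2) (b + 1) G.
  by have [] := @real_integral_sum r0 (a / 2) (b + 1) K g a20 (fun k _ => tg k).
have JG r' : real_integral r' G = \sum_(k < K) real_integral r' (g k).
  by have [] := @real_integral_sum r' (a / 2) (b + 1) K g a20 (fun k _ => tg k).
have cG : real_integral (r n) G @[n --> F] --> real_integral r0 G.
  under eq_cvg do rewrite JG.
  by rewrite JG; apply: (@cvg_big _ _ +%R) => //; exact: add_continuous.
have tf' : test_on (a / 2) (b + 1) f.
  by apply: test_on_widen tf; lra.
have tfG := test_onB tf' tG.
have e2 : 0 < e / 2 by rewrite divr_gt0.
move/cvgrPdist_le : cG => /(_ _ e2) cG.
have B0 : `|real_integral r0 f - real_integral r0 G| <= w * `|M0|.
  rewrite -(real_integralB _ tf' tG) (le_trans (real_integral_bound r0 tfG fg))//.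
  by rewrite ler_wpM2l ?(ltW w0)// ler_norm.
near=> m.
have Bm : `|real_integral (r m) f - real_integral (r m) G| <= w * `|M|.
  rewrite -(real_integralB _ tf' tG); apply: (@le_trans _ _ (w * M)).
    by near: m; apply: filterS HM => m; exact.
  by rewrite ler_wpM2l ?(ltW w0)// ler_norm.
have Gm : `|real_integral r0 G - real_integral (r m) G| <= e / 2 by near: m.
have wL : w * `|M| + w * `|M0| + w = e / 2.
  by rewrite -{3}(mulr1 w) -!mulrDr -/L /w mulfVK// gt_eqF.
have t1 := ler_normD (real_integral r0 f - real_integral r0 G)
  (real_integral r0 G - real_integral (r m) f).
have t2 := ler_normD (real_integral r0 G - real_integral (r m) G)
  (real_integral (r m) G - real_integral (r m) f).
rewrite !subrKA in t1 t2; rewrite distrC in Bm.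
move: t1 t2 B0 Bm Gm wL w0; clear; lra.
Unshelve. all: by end_near. Qed.

End tents.

(** * Compactness of the orbit and of the limit set *)

Section azarin_compactness.
Context {R : realType}.
Implicit Types (rho : R -> R) (mu nu : complex_radon R) (f : R -> R) (a b c x y : R)
  (t : {posnum R}).

Definition component_masses_le mu a b M :=
  [/\ fine (rpos (re_radon mu) `[a, b]%classic) <= M,
      fine (rneg (re_radon mu) `[a, b]%classic) <= M,
      fine (rpos (im_radon mu) `[a, b]%classic) <= M
    & fine (rneg (im_radon mu) `[a, b]%classic) <= M].

Lemma azarin_masses_bounded rho mu a b : proximate_order rho -> Minfty rho mu ->
  0 < a -> exists M : R, \forall s \near +oo%R, forall t, t%:num = s ->
    component_masses_le (azarin rho t mu) a b M.
Proof.
move=> hrho /Minfty_components[g1 g2 g3 g4] a0.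
have [M1 H1] := growth_bounded_segment b hrho g1 a0.
have [M2 H2] := growth_bounded_segment b hrho g2 a0.
have [M3 H3] := growth_bounded_segment b hrho g3 a0.
have [M4 H4] := growth_bounded_segment b hrho g4 a0.
pose M := Num.max (Num.max M1 M2) (Num.max M3 M4); exists M; near=> s => t ts.
split; rewrite pos_dilate_itv /= ts mulrC.
- by apply: (@le_trans _ _ M1); [near: s|rewrite !le_max lexx].
- by apply: (@le_trans _ _ M2); [near: s|rewrite !le_max lexx ?orbT].
- by apply: (@le_trans _ _ M3); [near: s|rewrite !le_max lexx ?orbT].
- by apply: (@le_trans _ _ M4); [near: s|rewrite !le_max lexx ?orbT].
Unshelve. all: by end_near. Qed.

Definition integrals_le mu a b M := forall f c, test_on a b f ->
  (forall x, `|f x| <= c) -> `|real_integral (re_radon mu) f| <= c * M /\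
                            `|real_integral (im_radon mu) f| <= c * M.

Lemma masses_integrals_le mu a b M :
  component_masses_le mu a b M -> integrals_le mu a b (M + M).
Proof.
move=> [h1 h2 h3 h4] f c tf fc; have c0 : 0 <= c by rewrite (le_trans _ (fc 0)).
split; apply: le_trans (real_integral_bound _ tf fc) _; rewrite ler_wpM2l//;
  exact: lerD.
Qed.

Lemma azarin_integrals_bounded rho mu a b : proximate_order rho -> Minfty rho mu ->
  0 < a -> exists M : R, \forall s \near +oo%R, forall t, t%:num = s ->
    integrals_le (azarin rho t mu) a b M.
Proof.
move=> hrho hmu a0; have [M H] := azarin_masses_bounded b hrho hmu a0.
exists (M + M); apply: filterS H => s H t ts; apply: masses_integrals_le; exact: H.
Qed.

Lemma integrals_le_uniformly_bounded (T : Type) (F : set_system T) {FF : Filter F}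
    (mu : T -> complex_radon R) :
  (forall a b, 0 < a -> exists M : R, \forall n \near F, integrals_le (mu n) a b M) ->
  uniformly_bounded F (fun n => re_radon (mu n)) /\
  uniformly_bounded F (fun n => im_radon (mu n)).
Proof.
by move=> H; split=> a b /(H a b)[M HM]; exists M; apply: filterS HM => n Hn f c tf fc;
  have [] := Hn f c tf fc.
Qed.

Lemma vague_integrals_le (T : Type) (F : set_system T) {FF : ProperFilter F}
    (mu : T -> complex_radon R) nu a b M : vague F mu nu ->
  (\forall n \near F, integrals_le (mu n) a b M) -> integrals_le nu a b M.
Proof.
move=> cmu H f c tf fc; have [cr ci] := cmu _ _ _ tf; split.
  by apply: (cvgr_to_le (cvg_norm cr)); apply: filterS H => n /(_ f c tf fc)[].
by apply: (cvgr_to_le (cvg_norm ci)); apply: filterS H => n /(_ f c tf fc)[].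
Qed.

(** The number of tests and the precision grow together with [j], so that
    closeness at every rank [j] of two sequences identifies their limits on all
    tests. *)
Definition tests_close mu nu (j : nat) := forall i, (i <= j)%N ->
  `|real_integral (re_radon nu) (tests i) - real_integral (re_radon mu) (tests i)|
    <= j.+1%:R^-1 /\
  `|real_integral (im_radon nu) (tests i) - real_integral (im_radon mu) (tests i)|
    <= j.+1%:R^-1.

Lemma vague_tests_close (T : Type) (F : set_system T) {FF : Filter F}
    (mu : T -> complex_radon R) nu j : vague F mu nu ->
  \forall n \near F, tests_close (mu n) nu j.
Proof.
move=> H; rewrite /tests_close.
have main N : \forall n \near F, forall i, (i < N)%N ->
  `|real_integral (re_radon nu) (tests i) -
    real_integral (re_radon (mu n)) (tests i)| <= j.+1%:R^-1 /\
  `|real_integral (im_radon nu) (tests i) -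
    real_integral (im_radon (mu n)) (tests i)| <= j.+1%:R^-1.
  elim: N => [|N IH]; first exact: nearW.
  have [a [b tN]] := @testsP R N.
  have [/cvgrPdist_le hr /cvgrPdist_le hi] := H _ _ _ tN.
  have e0 : 0 < j.+1%:R^-1 :> R by rewrite invr_gt0.
  near=> n => i; rewrite ltnS leq_eqVlt => /predU1P[->|iN].
    by split; near: n; [exact: hr|exact: hi].
  by move: i iN; near: n.
exact: main j.+1.
Unshelve. all: by end_near. Qed.

Lemma tests_closeC mu nu j : tests_close mu nu j -> tests_close nu mu j.
Proof. by move=> H i /H[h1 h2]; split; rewrite distrC. Qed.

Lemma tests_close_cvg (mu nu : nat -> complex_radon R) :
  (forall j, tests_close (mu j) (nu j) j) -> forall i,
  (forall l : R, real_integral (re_radon (mu j)) (tests i) @[j --> \oo] --> l ->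
     real_integral (re_radon (nu j)) (tests i) @[j --> \oo] --> l) /\
  (forall l : R, real_integral (im_radon (mu j)) (tests i) @[j --> \oo] --> l ->
     real_integral (im_radon (nu j)) (tests i) @[j --> \oo] --> l).
Proof.
move=> H i.
have small (v u : nat -> R) : (forall j, (i <= j)%N -> `|v j - u j| <= j.+1%:R^-1) ->
    forall l : R, u j @[j --> \oo] --> l -> v j @[j --> \oo] --> l.
  move=> vu l; apply: cvg_sub0; apply/cvgrPdist_le => e e0.
  have /cvgrPdist_le /(_ _ e0) [N _ HN] := @cvg_harmonic R.
  exists (maxn N i) => // j /=; rewrite geq_max => /andP[Nj ij].
  have := HN j Nj; rewrite /= !sub0r !normrN ger0_norm ?invr_ge0//.
  by apply: le_trans; exact: vu.
by split; apply: small => j /(H j)[].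
Qed.

Lemma tests_vague (T : Type) (F : set_system T) {FF : ProperFilter F}
    (mu : T -> complex_radon R) nu :
    (forall a b, 0 < a -> exists M : R, \forall n \near F, integrals_le (mu n) a b M) ->
    (forall i,
      real_integral (re_radon (mu n)) (tests i) @[n --> F] -->
        real_integral (re_radon nu) (tests i) /\
      real_integral (im_radon (mu n)) (tests i) @[n --> F] -->
        real_integral (im_radon nu) (tests i)) ->
  vague F mu nu.
Proof.
move=> /integrals_le_uniformly_bounded[br bi] c a b f tf.
by split; [apply: tests_determine br _ _ _ _ tf|apply: tests_determine bi _ _ _ _ tf] => i;
  have [] := c i.
Qed.

Lemma increasing_cvgny (k : nat -> nat) : increasing_seq k -> k n @[n --> \oo] --> \oo.
Proof.
move=> /increasing_seqP ik; apply/cvgnyPge => A; exists A => // n /= An.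
by apply: (leq_trans An); elim: n {An} => // n IH; exact: leq_ltn_trans (ik n).
Qed.

(** Every set of the ultrafilter is unbounded, so each rank [j] is reached by
    some index larger than the previous one; convergence on the tests then
    extends to all test functions. *)
Lemma close_subsequence (mu : nat -> complex_radon R) nu (U : set_system nat) :
    UltraFilter U -> \oo `<=` U -> vague U mu nu ->
    (forall a b, 0 < a -> exists M : R, \forall n \near \oo, integrals_le (mu n) a b M) ->
  exists k : nat -> nat, increasing_seq k /\ vague \oo (mu \o k) nu.
Proof.
move=> UU ooU cU bmu.
have step j N : exists n, (N < n)%N /\ tests_close (mu n) nu j.
  have : U ([set n | (N < n)%N] `&` [set n | tests_close (mu n) nu j]).
    by apply: filterI; [apply: ooU; exists N.+1|exact: vague_tests_close].
  by move=> /filter_ex[n []]; exists n.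
have /choice[g gP] : forall p : nat * nat, exists n,
    (p.2 < n)%N /\ tests_close (mu n) nu p.1.
  by move=> [j N]; exact: step.
pose k := fix k (j : nat) := if j is j'.+1 then g (j, k j') else g (0, 0)%N.
have kS j : (k j < k j.+1)%N by have [] := gP (j.+1, k j).
have kc j : tests_close (mu (k j)) nu j.
  by case: j => [|j]; [have [] := gP (0, 0)%N|have [] := gP (j.+1, k j)].
have ik : increasing_seq k by apply/increasing_seqP.
have koo := increasing_cvgny ik.
exists k; split => // a b f tf.
have bk a' b' : 0 < a' ->
    exists M : R, \forall n \near \oo, integrals_le ((mu \o k) n) a' b' M.
  by move=> /(bmu a' b')[M HM]; exists M; exact: koo HM.
apply: tests_vague bk _ _ _ _ tf => i.
have [c1 c2] := tests_close_cvg (fun j => tests_closeC (kc j)) i.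
have h1 := c1 (real_integral (re_radon nu) (tests i)) (@cvg_cst _ _ _ _ _).
have h2 := c2 (real_integral (im_radon nu) (tests i)) (@cvg_cst _ _ _ _ _).
by split; [exact: h1|exact: h2].
Qed.

Lemma azarin_ultra_limit rho mu (T : Type) (U : set_system T) (t : T -> {posnum R}) :
    proximate_order rho -> Minfty rho mu -> UltraFilter U ->
    (t n)%:num @[n --> U] --> +oo%R ->
  exists nu, vague U (fun n => azarin rho (t n) mu) nu.
Proof.
move=> hrho hmu UU too.
have bd a b : 0 < a -> exists M : R, \forall n \near U,
    component_masses_le (azarin rho (t n) mu) a b M.
  move=> /(azarin_masses_bounded b hrho hmu)[M HM]; exists M.
  by apply: (@filterS _ U) (too _ HM) => n /(_ _ erefl).
have lim (m : T -> pos_radon R) : (forall a b, 0 < a -> exists M : R,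
      \forall n \near U, fine (m n `[a, b]%classic) <= M) ->
    exists m0 : pos_radon R, forall a b f, test_on a b f ->
      mint (m n) f @[n --> U] --> mint m0 f.
  exact: helly_ultra.
have [|p1 c1] := lim (fun n => rpos (re_radon (azarin rho (t n) mu))).
  by move=> a b /(bd a b)[M HM]; exists M; apply: filterS HM => n [].
have [|q1 d1] := lim (fun n => rneg (re_radon (azarin rho (t n) mu))).
  by move=> a b /(bd a b)[M HM]; exists M; apply: filterS HM => n [].
have [|p2 c2] := lim (fun n => rpos (im_radon (azarin rho (t n) mu))).
  by move=> a b /(bd a b)[M HM]; exists M; apply: filterS HM => n [].
have [|q2 d2] := lim (fun n => rneg (im_radon (azarin rho (t n) mu))).
  by move=> a b /(bd a b)[M HM]; exists M; apply: filterS HM => n [].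
have [r1 e1] := jordan_integral p1 q1; have [r2 e2] := jordan_integral p2 q2.
exists (ComplexRadon r1 r2) => a b f tf /=; rewrite (e1 _ _ _ tf) (e2 _ _ _ tf).
by split; apply: cvgB; [exact: c1 tf|exact: d1 tf|exact: c2 tf|exact: d2 tf].
Qed.

Lemma azarin_bounded_along rho mu (T : Type) (F : set_system T) {FF : Filter F}
    (t : T -> {posnum R}) : proximate_order rho -> Minfty rho mu ->
    (t n)%:num @[n --> F] --> +oo%R ->
  forall a b, 0 < a -> exists M : R, \forall n \near F,
    integrals_le (azarin rho (t n) mu) a b M.
Proof.
move=> hrho hmu too a b /(azarin_integrals_bounded b hrho hmu)[M HM]; exists M.
by apply: (@filterS _ F) (too _ HM) => n /(_ _ erefl).
Qed.

Theorem azarin_subsequence rho mu (t : nat -> {posnum R}) :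
    proximate_order rho -> Minfty rho mu -> (t n)%:num @[n --> \oo] --> +oo%R ->
  exists k nu, increasing_seq k /\ vague \oo (fun n => azarin rho (t (k n)) mu) nu.
Proof.
move=> hrho hmu too.
have [U [UU ooU]] := @ultraFilterLemma nat \oo _.
have [|nu cU] := azarin_ultra_limit hrho hmu UU (t := t).
  by apply: cvg_trans too => B; exact: ooU.
have [k [ik ck]] := close_subsequence UU ooU cU (azarin_bounded_along hrho hmu too).
by exists k, nu.
Qed.

Lemma Fr_vague rho mu nu : Fr rho mu nu <-> exists t : nat -> {posnum R},
  (t n)%:num @[n --> \oo] --> +oo%R /\ vague \oo (fun n => azarin rho (t n) mu) nu.
Proof. by split=> -[t [too /wide_cvgP c]]; exists t. Qed.

Lemma Fr_subsequence rho mu (t : nat -> {posnum R}) :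
    proximate_order rho -> Minfty rho mu -> (t n)%:num @[n --> \oo] --> +oo%R ->
  exists k nu, [/\ increasing_seq k, Fr rho mu nu &
    vague \oo (fun n => azarin rho (t (k n)) mu) nu].
Proof.
move=> hrho hmu too; have [k [nu [ik ck]]] := azarin_subsequence hrho hmu too.
exists k, nu; split => //; apply/Fr_vague; exists (t \o k); split => //.
exact: (cvg_comp _ _ (increasing_cvgny ik) too).
Qed.

Lemma Fr_nonempty rho mu : proximate_order rho -> Minfty rho mu -> Fr rho mu !=set0.
Proof.
move=> hrho hmu; have p n : 0 < n.+1%:R :> R by [].
have [|k [nu [_ Fnu _]]] := @Fr_subsequence rho mu (fun n => PosNum (p n)) hrho hmu.
  apply/cvgryPge => A /=; near=> n.
  have An : A <= n%:R by near: n; exact: nbhs_infty_ger.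
  by rewrite (le_trans An)// ler_nat.
by exists nu.
Unshelve. all: by end_near. Qed.

Lemma Fr_bounded rho mu : proximate_order rho -> Minfty rho mu ->
  forall a b, 0 < a -> exists M : R, forall nu, Fr rho mu nu -> integrals_le nu a b M.
Proof.
move=> hrho hmu a b /(azarin_integrals_bounded b hrho hmu)[M HM]; exists M => nu.
move=> /Fr_vague[t [too c]]; apply: (vague_integrals_le c).
by apply: (@filterS _ \oo) (too _ HM) => n /(_ _ erefl).
Qed.

(** Each [nu j] is approximated at rank [j] by a point of the orbit at time at
    least [j].  A convergent subsequence of these points has its limit in the
    limit set, and the corresponding subsequence of [nu] has the same limit. *)
Lemma Fr_compact rho mu : proximate_order rho -> Minfty rho mu ->
  wide_compact (Fr rho mu).
Proof.
move=> hrho hmu nu Fnu.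
have close j : exists t : {posnum R}, j%:R <= t%:num /\
    tests_close (azarin rho t mu) (nu j) j.
  have /Fr_vague[t [too c]] := Fnu j.
  have [n []] : exists n, j%:R <= (t n)%:num /\ tests_close (azarin rho (t n) mu) (nu j) j.
    apply: (@filter_ex _ \oo); near=> n; split; near: n; last exact: vague_tests_close.
    by move/cvgryPge : too; exact.
  by exists (t n).
have [s sP] := choice close.
have soo : (s n)%:num @[n --> \oo] --> +oo%R.
  apply/cvgryPge => A; near=> n; have [+ _] := sP n; apply: le_trans.
  by near: n; exact: nbhs_infty_ger.
have [k [nu0 [ik F0 c0]]] := Fr_subsequence hrho hmu soo.
exists k; split => //; exists nu0; split => //; apply/wide_cvgP.
have kge j : (j <= k j)%N.
  by move/increasing_seqP : ik => ik; elim: j => // j IH; exact: leq_ltn_trans (ik j).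
have kc j : tests_close (azarin rho (s (k j)) mu) (nu (k j)) j.
  move=> i ij; have [_ /(_ i (leq_trans ij (kge j)))[h1 h2]] := sP (k j).
  have kj : (k j).+1%:R^-1 <= j.+1%:R^-1 :> R.
    by rewrite lef_pV2 ?posrE ?ltr0n// ler_nat ltnS.
  by split; [exact: le_trans h1 kj|exact: le_trans h2 kj].
apply: tests_vague => [a b a0|i].
  have [M HM] := Fr_bounded hrho hmu b a0; exists M; apply: nearW => n.
  by apply: HM; exact: Fnu.
have [c1 c2] := tests_close_cvg kc i.
have [a [b ti]] := @testsP R i; have [d1 d2] := c0 _ _ _ ti.
by split; [exact: c1|exact: c2].
Unshelve. all: by end_near. Qed.

End azarin_compactness.

(** * Invariance under the dilations F_t *)

Section Ft_bijection.
Context {R : realType}.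
Local Notation TR := (measurableTypeR R).
Implicit Types (rho : R -> R) (mu nu : complex_radon R) (f : R -> R) (a b x y : R)
  (c t : {posnum R}).

Lemma pos_radon_inj (m1 m2 : pos_radon R) : (forall E : set TR, m1 E = m2 E) -> m1 = m2.
Proof.
case: m1 m2 => [m1 o1 f1 n1] [m2 o2 f2 n2] /= E.
have e : m1 = m2 by apply: eq_measure; apply/funext => A; exact: E.
by subst m2; congr PosRadon; exact: Prop_irrelevance.
Qed.

Lemma real_radon_inj (r1 r2 : real_radon R) :
  rpos r1 = rpos r2 -> rneg r1 = rneg r2 -> r1 = r2.
Proof.
case: r1 r2 => [p1 q1 s1] [p2 q2 s2] /= pp qq; subst p2 q2.
by congr RealRadon; exact: Prop_irrelevance.
Qed.

Lemma dilate_inverse c c' t t' nu : c%:num * c'%:num = 1 ->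
  (forall E, scale_set t (scale_set t' E) = E) ->
  dilate c' t' (dilate c t nu) = nu.
Proof.
move=> cc tt.
have pE (m : pos_radon R) : pos_dilate c' t' (pos_dilate c t m) = m.
  apply: pos_radon_inj => E /=; rewrite /pos_dilate_measure /= /pos_dilate_measure.
  by rewrite muleA -EFinM mulrC cc mul1e tt.
have rE (r : real_radon R) : real_dilate c' t' (real_dilate c t r) = r.
  by apply: real_radon_inj; exact: pE.
by case: nu => r1 r2; rewrite /dilate /= !rE.
Qed.

Lemma FtK rho t nu : Ft rho (t%:num^-1)%:pos (Ft rho t nu) = nu.
Proof.
apply: dilate_inverse; last exact: scale_setVK.
rewrite /= -powRM ?invr_ge0//; first by rewrite mulfV// powR1.
Qed.

Lemma FtVK rho t nu : Ft rho t (Ft rho (t%:num^-1)%:pos nu) = nu.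
Proof.
apply: dilate_inverse; last exact: scale_setK.
rewrite /= -powRM ?invr_ge0//; first by rewrite mulVf// powR1.
Qed.

Lemma Ft_Fr rho mu t nu : proximate_order rho -> Fr rho mu nu -> Fr rho mu (Ft rho t nu).
Proof.
move=> hrho /Fr_vague[s [soo cs]]; apply/Fr_vague.
have st0 n : 0 < (s n)%:num * t%:num by rewrite mulr_gt0.
pose st n := PosNum (st0 n); exists st; split.
  exact: (cvg_comp _ _ soo (cvg_shift_scale [gt0 of t%:num])).
have cV : Vord rho (s n)%:num / Vord rho ((s n)%:num * t%:num) @[n --> \oo] -->
    t%:num `^ (- rho_infty rho).
  have := cvg_comp _ _ soo (Vord_ratio hrho [gt0 of t%:num]).
  move=> /cvgV; rewrite gt_eqF ?powR_gt0// => /(_ isT).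
  rewrite powRN; apply: cvg_trans; apply: near_eq_cvg; apply: nearW => n /=.
  by rewrite invf_div.
have key (r r0 : real_radon R) :
   (forall a b f, test_on a b f -> 
     real_integral (real_dilate (PosNum (Vord_inv_gt0 rho (s n))) (s n) r) f
      @[n --> \oo] --> real_integral r0 f) ->
   forall a b f, test_on a b f -> 
     real_integral (real_dilate (PosNum (Vord_inv_gt0 rho (st n))) (st n) r) f
      @[n --> \oo] --> real_integral (real_dilate (PosNum (Ft_factor_gt0 rho t)) t r0) f.
  move=> c a b f tf; have tf' := test_on_dilate t tf.
  rewrite (real_integral_dilate _ _ _ tf).
  have : Vord rho (s n)%:num / Vord rho ((s n)%:num * t%:num) *
      real_integral (real_dilate (PosNum (Vord_inv_gt0 rho (s n))) (s n) r)
        (fun x => f (t%:num^-1 * x)) @[n --> \oo] -->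
      t%:num `^ (- rho_infty rho) * real_integral r0 (fun x => f (t%:num^-1 * x)).
    by apply: cvgM cV (c _ _ _ tf').
  apply: cvg_trans; apply: near_eq_cvg; apply: nearW => n /=.
  rewrite ?fctE (real_integral_dilate _ _ _ tf') (real_integral_dilate _ _ _ tf) /=.
  have V0 : Vord rho (s n)%:num != 0 by rewrite gt_eqF ?powR_gt0.
  have VK (V W J : R) : V != 0 -> V / W * (V^-1 * J) = W^-1 * J.
    by move=> V1; rewrite mulrACA mulfV// mul1r.
  rewrite [X in X = _]VK//; congr (_ * real_integral _ _).
  by apply/funext => x; rewrite invfM mulrA [_^-1 * _^-1]mulrC.
move=> a b f tf; split.
  exact: (key (re_radon mu) (re_radon nu) (fun _ _ _ tg => (cs _ _ _ tg).1) _ _ _ tf).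
exact: (key (im_radon mu) (im_radon nu) (fun _ _ _ tg => (cs _ _ _ tg).2) _ _ _ tf).
Qed.

Lemma Ft_bij rho mu t : proximate_order rho -> set_bij (Fr rho mu) (Fr rho mu) (Ft rho t).
Proof.
move=> hrho; split.
- by move=> nu Fnu; exact: Ft_Fr.
- by move=> nu nu' _ _ e; rewrite -(FtK rho t nu) e FtK.
- by move=> nu Fnu; exists (Ft rho (t%:num^-1)%:pos nu); [exact: Ft_Fr|exact: FtVK].
Qed.

End Ft_bijection.

(** * Connectedness *)

Section connectedness.
Local Open Scope complex_scope.
Context {R : realType}.
Implicit Types (rho : R -> R) (mu nu : complex_radon R) (f : R -> R) (a b c x y s : R)
  (t : {posnum R}).

(** The orbit with time on the logarithmic scale, where every real is a time. *)
Definition log_orbit rho mu s : complex_radon R := azarin rho (PosNum (expR_gt0 s)) mu.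

Lemma azarin_log_orbit rho mu t : azarin rho t mu = log_orbit rho mu (ln t%:num).
Proof. by congr (azarin rho _ mu); apply/val_inj; rewrite /= lnK ?posrE. Qed.

(** On the logarithmic scale the dilation is a translation, so the dilated
    functions converge uniformly; near [s0] their supports lie in a common
    segment. *)
Lemma dilated_test_continuous (r : real_radon R) a b f s0 : test_on a b f ->
  real_integral r (fun x => f ((expR s)^-1 * x)) @[s --> s0] -->
  real_integral r (fun x => f ((expR s0)^-1 * x)).
Proof.
move=> tf; have [a0 cf f0] := tf; apply/cvgrPdist_le => e e0.
pose g y := f (expR y).
have cg : continuous g.
  by move=> z; apply: continuous_comp; [exact: continuous_expR|exact: cf].
have g0 y : ~ (ln a <= y <= ln b) -> g y = 0.
  move=> ny; apply: f0 => /andP[ay yb]; apply: ny.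
  have b0 : 0 < b by rewrite (lt_le_trans (expR_gt0 y)).
  by rewrite -[y]expRK !ler_ln ?posrE ?expR_gt0// ay.
pose a' := expR (s0 - 1) * a; pose b' := expR (s0 + 1) * `|b|.
have a'0 : 0 < a' by rewrite mulr_gt0 ?expR_gt0.
pose M := variation_mass r a' b'.
have M0 : 0 <= M by rewrite addr_ge0// fine_ge0.
pose w := e / (M + 1); have w0 : 0 < w by rewrite divr_gt0// ltr_wpDl.
have [h h0 gh] := compactly_supported_unif cg g0 w0.
near=> s.
have sh : `|s0 - s| < h by near: s; exact: cvgr_dist_lt.
have s1 : `|s0 - s| < 1 by near: s; exact: cvgr_dist_lt.
have td u : `|s0 - u| < 1 -> test_on a' b' (fun x => f ((expR u)^-1 * x)).
  move=> u1; apply: test_on_widen (test_on_dilate (PosNum (expR_gt0 u)) tf) => //=.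
    rewrite /a' ler_pM2r// ler_expR; move: u1; rewrite ltr_norml; lra.
  apply: (@le_trans _ _ (expR u * `|b|)).
    by rewrite ler_pM2l ?expR_gt0// ler_norm.
  rewrite /b' ler_wpM2r// ler_expR; move: u1; rewrite ltr_norml; lra.
have t0 := td s0; rewrite subrr normr0 ltr01 in t0.
rewrite -(real_integralB r (t0 isT) (td s s1)).
apply: (@le_trans _ _ (w * M)); last first.
  by rewrite /w mulrAC ler_pdivrMr ?ltr_wpDl// ler_pM2l// lerDl.
apply: real_integral_bound; first exact: test_onB (t0 isT) (td s s1).
move=> x; have [x0|x0] := ltP 0 x; last first.
  have fz u : f ((expR u)^-1 * x) = 0.
    apply: f0 => /andP[+ _]; apply/negP; rewrite -ltNge (le_lt_trans _ a0)//.
    by rewrite pmulr_rle0 ?invr_gt0 ?expR_gt0.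
  by rewrite !fz subrr normr0 ltW.
have xE u : (expR u)^-1 * x = expR (ln x - u).
  by rewrite expRD lnK ?posrE// expRN mulrC.
rewrite !xE; apply: gh.
by rewrite (_ : _ - _ = s - s0) ?[`|s - s0|]distrC//; ring.
Unshelve. all: by end_near. Qed.

Lemma log_orbit_continuous rho mu s0 : proximate_order rho -> 0 < s0 ->
  vague (nbhs s0) (log_orbit rho mu) (log_orbit rho mu s0).
Proof.
move=> hrho s00 a b f tf.
have cV : (Vord rho (expR s))^-1 @[s --> s0] --> (Vord rho (expR s0))^-1.
  apply: cvgV; first by rewrite gt_eqF// powR_gt0// expR_gt0.
  apply: (@cvg_comp _ _ _ (@expR R) (Vord rho) (nbhs s0) (nbhs (expR s0))).
    exact: continuous_expR.
  apply: Vord_continuous => //.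
  by rewrite -expR0 ltr_expR.
have key (r : real_radon R) :
    let t u := PosNum (expR_gt0 u) in
    real_integral (real_dilate (PosNum (Vord_inv_gt0 rho (t s))) (t s) r) f
      @[s --> s0] -->
    real_integral (real_dilate (PosNum (Vord_inv_gt0 rho (t s0))) (t s0) r) f.
  move=> t; under eq_cvg do rewrite (real_integral_dilate _ _ _ tf).
  rewrite (real_integral_dilate _ _ _ tf).
  by apply: cvgM; [exact: cV|exact: dilated_test_continuous tf].
by split; exact: key.
Qed.

Section metric.
Context (phi : nat -> R -> R[i]) (Phi_phi : forall n, Phi (phi n)).
Local Notation d := (radon_dist phi).

Lemma radon_dist_ge0 mu nu : 0 <= d mu nu.
Proof.
apply: limr_ge; first exact: is_cvg_radon_dist.
apply: nearW => n.
by rewrite /series /= sumr_ge0// => i _; exact: radon_dist_term_ge0.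
Qed.

(** Each term of the series is at most the modulus of the difference of the
    pairings, and the [k]-th one at most [2 ^ -(k+1)]. *)
Lemma radon_dist_le N mu nu : d mu nu <=
  \sum_(k < N) Normc.normc (pairing mu (phi k) - pairing nu (phi k)) + (2 ^+ N)^-1.
Proof.
pose p k := Normc.normc (pairing mu (phi k) - pairing nu (phi k)).
have p0 k : 0 <= p k by rewrite /p; case: (_ - _) => u v; exact: sqrtr_ge0.
have tE k : radon_dist_term phi mu nu k = (2 ^+ k.+1)^-1 * (p k / (1 + p k)).
  by rewrite /radon_dist_term -/(p k) invfM mulrCA.
have h0 k : 0 < (2 ^+ k)^-1 :> R by rewrite invr_gt0 exprn_gt0.
have q1 k : 0 <= p k / (1 + p k) <= 1.
  rewrite divr_ge0 ?addr_ge0//= ler_pdivrMr ?mul1r ?lerDr//.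
  by rewrite ltr_pwDl.
have tp k : radon_dist_term phi mu nu k <= p k.
  rewrite tE (@le_trans _ _ (p k / (1 + p k)))//.
    rewrite ler_piMl//; first by have /andP[] := q1 k.
    by rewrite invf_le1 ?exprn_gt0// exprn_ege1// ler1n.
  by rewrite ler_pdivrMr ?ltr_pwDl// ler_peMr// lerDl.
have t2 k : radon_dist_term phi mu nu k <= (2 ^+ k.+1)^-1.
  by rewrite tE ler_piMr ?(ltW (h0 _))//; have /andP[] := q1 k.
have hS k : (2 ^+ k)^-1 = (2 ^+ k.+1)^-1 + (2 ^+ k.+1)^-1 :> R.
  by rewrite exprS invfM; lra.
apply: limr_le; first exact: is_cvg_radon_dist.
exists N => // n /= Nn.
rewrite -(subnKC Nn) /series /=.
suff H j : \sum_(0 <= k < N + j) radon_dist_term phi mu nu k <=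
    \sum_(k < N) p k + ((2 ^+ N)^-1 - (2 ^+ (N + j))^-1).
  by apply: le_trans (H _) _; rewrite lerD2l gerBl ltW.
elim: j => [|j IH].
  by rewrite addn0 subrr addr0 big_mkord; apply: ler_sum => k _; exact: tp.
rewrite addnS big_nat_recr//=; have := t2 (N + j)%N; have := hS (N + j)%N; lra.
Qed.

Lemma radon_dist_cvg (T : Type) (F : set_system T) {FF : Filter F}
    (m : T -> complex_radon R) nu :
  vague F m nu -> forall e : R, 0 < e -> \forall n \near F, d (m n) nu <= e.
Proof.
move=> /vague_pairing cm e e0; have e2 : 0 < e / 2 by rewrite divr_gt0.
pose N := Num.truncn (e / 2)^-1.
have Ne : (2 ^+ N)^-1 <= e / 2 :> R.
  rewrite -[leRHS]invrK lef_pV2 ?posrE ?invr_gt0 ?exprn_gt0//.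
  apply: (le_trans (ltW (truncnS_gt _))); rewrite -natrX ler_nat; exact: ltn_expl.
have c0 : \sum_(k < N) Normc.normc (pairing (m n) (phi k) - pairing nu (phi k))
    @[n --> F] --> \sum_(k < N) (0 : R).
  apply: (@cvg_big _ _ +%R 0 _ (@add_continuous R) _ _ _ _ (fun=> 0)) => k _.
  apply/cvgrPdist_le => e' e'0.
  have /cvg_normcP /(_ _ e'0) := cm _ (Phi_phi k); apply: filterS => n.
  rewrite sub0r normrN -normcN opprB ger0_norm//.
  by case: (_ - _) => u v; exact: sqrtr_ge0.
rewrite big1// in c0.
move/cvgrPdist_le : c0 => /(_ _ e2); apply: filterS => n.
rewrite sub0r normrN => h; apply: le_trans (radon_dist_le N _ _) _.
by rewrite [leRHS]splitr lerD// (le_trans (ler_norm _)).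
Qed.

Definition dist_to (B : set (complex_radon R)) mu : R := inf [set d mu nu | nu in B].

Section dist_to.
Context (B : set (complex_radon R)) (nu0 : complex_radon R) (Bnu0 : B nu0).

Let has_inf_dist mu : has_inf [set d mu nu | nu in B].
Proof.
split; first by exists (d mu nu0), nu0.
by exists 0 => _ [nu _ <-]; exact: radon_dist_ge0.
Qed.

Lemma dist_to_le mu nu : B nu -> dist_to B mu <= d mu nu.
Proof. by move=> Bnu; apply: ge_inf; [exact: (has_inf_dist mu).2|exists nu]. Qed.

Lemma dist_to_ge mu e : (forall nu, B nu -> e <= d mu nu) -> e <= dist_to B mu.
Proof.
move=> H; apply: lb_le_inf; first exact: (has_inf_dist mu).1.
by move=> _ [nu Bnu <-]; exact: H.
Qed.

Lemma dist_to_lip mu nu : `|dist_to B mu - dist_to B nu| <= d mu nu.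
Proof.
have key m n : dist_to B m - d m n <= dist_to B n.
  apply: dist_to_ge => p Bp; rewrite lerBlDl.
  exact: le_trans (dist_to_le m Bp) (radon_distD _ _ _ _).
have := key mu nu; have := key nu mu; rewrite (radon_distC phi nu mu) ler_norml.
move: (dist_to B mu) (dist_to B nu) (d mu nu) => x y z h1 h2.
by apply/andP; split; lra.
Qed.

End dist_to.

(** The function [h] below is continuous, negative on [B] and positive on [C].
    The orbit comes close to both sets at arbitrarily large times, hence has
    zeros of [h] at arbitrarily large times; the orbit along these zeros
    accumulates at a point of the limit set where [h] vanishes. *)
Lemma no_separation rho mu (B C : set (complex_radon R)) :
    proximate_order rho -> Minfty rho mu -> B !=set0 -> C !=set0 ->
    (forall nu, Fr rho mu nu <-> B nu \/ C nu) ->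
    (forall m, B m -> exists2 e : R, 0 < e & forall n, C n -> e <= d m n) ->
    (forall m, C m -> exists2 e : R, 0 < e & forall n, B n -> e <= d m n) -> False.
Proof.
move=> hrho hmu [b0 Bb0] [c0 Cc0] FE sepB sepC.
pose h nu := dist_to B nu - dist_to C nu.
have hlip m n e : d m n <= e / 2 -> `|h m - h n| <= e.
  have sub4 (x y z w : R) : (x - y) - (z - w) = (x - z) - (y - w) by ring.
  move=> mn; rewrite /h sub4 [leRHS]splitr (le_trans (ler_normB _ _))// lerD//.
    exact: le_trans (dist_to_lip Bb0 m n) mn.
  exact: le_trans (dist_to_lip Cc0 m n) mn.
have hB m : B m -> h m < 0.
  move=> Bm; have [e e0 He] := sepB m Bm.
  rewrite subr_lt0 (le_lt_trans (dist_to_le Bb0 m Bm))// radon_distxx.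
  exact: lt_le_trans e0 (dist_to_ge Cc0 He).
have hC m : C m -> 0 < h m.
  move=> Cm; have [e e0 He] := sepC m Cm.
  rewrite subr_gt0 (le_lt_trans (dist_to_le Cc0 m Cm))// radon_distxx.
  exact: lt_le_trans e0 (dist_to_ge Bb0 He).
(* Only these three properties of [h] are used below. *)
clearbody h.
pose k s := h (log_orbit rho mu s).
have near_orbit nu (n : nat) (e : R) : Fr rho mu nu -> 0 < e ->
    exists2 s, n.+1%:R <= s & `|k s - h nu| <= e.
  move=> /Fr_vague[t [too ct]] e0; have e2 : 0 < e / 2 by rewrite divr_gt0.
  have [j [nj dj]] : exists j,
      expR n.+1%:R <= (t j)%:num /\ d (azarin rho (t j) mu) nu <= e / 2.
    apply: (@filter_ex _ \oo); near=> j; split; near: j.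
      by move/cvgryPge : too; exact.
    exact: radon_dist_cvg.
  exists (ln (t j)%:num); first by rewrite -[leLHS]expRK ler_ln ?posrE ?expR_gt0.
  by rewrite /k -azarin_log_orbit; exact: hlip.
have kcont s0 : 0 < s0 -> {for s0, continuous k}.
  move=> s00; apply/cvgrPdist_le => e e0; have e2 : 0 < e / 2 by rewrite divr_gt0.
  have ds : \forall s \near s0, d (log_orbit rho mu s) (log_orbit rho mu s0) <= e / 2.
    exact: radon_dist_cvg (log_orbit_continuous mu hrho s00) _ e2.
  by apply: filterS ds => s ds; rewrite distrC; exact: hlip.
have kzero (n : nat) : exists s, n.+1%:R <= s /\ k s = 0.
  have hb := hB _ Bb0; have hc := hC _ Cc0.
  have [||x nx kx] := near_orbit b0 n (- h b0 / 2).
  - by apply/FE; left.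
  - by rewrite divr_gt0// oppr_gt0.
  have [||y ny ky] := near_orbit c0 n (h c0 / 2).
  - by apply/FE; right.
  - by rewrite divr_gt0.
  have kx0 : k x <= 0.
    by move: (k x) (h b0) hb kx => u v v0; rewrite ler_norml => /andP[_]; lra.
  have ky0 : 0 <= k y.
    by move: (k y) (h c0) hc ky => u v v0; rewrite ler_norml => /andP[]; lra.
  have pos z : n.+1%:R <= z -> 0 < z by apply: lt_le_trans; rewrite ltr0n.
  have cw u v : n.+1%:R <= u -> {within `[u, v], continuous k}.
    move=> nu'; apply: continuous_in_subspaceT => z.
    rewrite inE/= in_itv/= => /andP[uz _].
    by apply: kcont; apply: pos; exact: le_trans uz.
  have [xy|/ltW yx] := leP x y.
    have [|z zxy kz] := IVT xy (cw _ _ nx) (v := 0).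
      by rewrite ge_min le_max kx0 ky0 orbT.
    exists z; split => //; move: zxy; rewrite in_itv/= => /andP[xz _].
    exact: le_trans xz.
  have [|z zxy kz] := IVT yx (cw _ _ ny) (v := 0).
    by rewrite ge_min le_max kx0 ky0 orbT.
  exists z; split => //; move: zxy; rewrite in_itv/= => /andP[yz _].
  exact: le_trans yz.
have [s sP] := choice kzero.
have soo : expR (s n) @[n --> \oo] --> +oo%R.
  apply/cvgryPge => A; near=> n; have [ns _] := sP n.
  apply: (@le_trans _ _ n%:R); first by near: n; exact: nbhs_infty_ger.
  apply: le_trans (expR_ge1Dx _); apply: le_trans (_ : _ <= s n) _.
    by rewrite (le_trans _ ns)// ler_nat.
  by rewrite lerDr.
have [j [nu [ij Fnu cnu]]] :=
  @Fr_subsequence R rho mu (fun n => PosNum (expR_gt0 (s n))) hrho hmu soo.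
have hnu : h nu = 0.
  apply/eqP; rewrite -normr_eq0 eq_le normr_ge0 andbT; apply/ler_addgt0Pl => e e0.
  rewrite addr0; have e2 : 0 < e / 2 by rewrite divr_gt0.
  have [n Hn] := filter_ex (radon_dist_cvg cnu e2).
  have [_ kn] := sP (j n); have := hlip (log_orbit rho mu (s (j n))) nu e Hn.
  by rewrite -/(k (s (j n))) kn sub0r normrN.
by have /FE[/hB|/hC] := Fnu; rewrite hnu ltxx.
Unshelve. all: by end_near. Qed.

Lemma radon_open_ball (U : set (radon_metric phi)) (nu : radon_metric phi) :
  open U -> U nu -> exists2 e : R, 0 < e & forall nu', d nu nu' < e -> U nu'.
Proof.
move=> oU Unu; have /nbhs_ballP[e /= e0 eU] : nbhs nu U by exact: open_nbhs_nbhs.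
by exists e => // nu' h; exact: eU.
Qed.

Theorem Fr_connected rho mu : proximate_order rho -> Minfty rho mu ->
  connected (Fr rho mu : set (radon_metric phi)).
Proof.
move=> hrho hmu B Bn0 [U oU BU] [W cW BW].
apply/seteqP; split => [x|x Fx]; first by rewrite BU => -[].
apply: contrapT => nBx.
apply: (@no_separation rho mu B (Fr rho mu `\` B) hrho hmu Bn0).
- by exists x.
- move=> nu; split.
    move=> Fnu; have [Bnu|nB] := pselect (B nu); first by left.
    by right; split; [exact: Fnu|exact: nB].
  case; last by move=> [Fnu _]; exact: Fnu.
  by rewrite BU => -[Fnu _]; exact: Fnu.
- move=> b Bb; have Ub : U b by move: Bb; rewrite BU => -[].
  have [e e0 eU] := radon_open_ball oU Ub; exists e => // c [Fc nBc].
  rewrite leNgt; apply/negP => /eU Uc; apply: nBc; rewrite BU; split => //.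
move=> c [Fc nBc].
have nWc : (~` W) c by move=> Wc; apply: nBc; rewrite BW.
have [e e0 eW] := radon_open_ball (closed_openC cW) nWc; exists e => // b.
by rewrite BW => -[_ Wb]; rewrite leNgt; apply/negP => /eW.
Qed.

End metric.
End connectedness.

Theorem theorem3p10 (R : realType) (rho : R -> R) (hrho : proximate_order rho)
    (mu : complex_radon R) (hmu : Minfty rho mu) :
  [/\ Fr rho mu !=set0 /\ wide_compact (Fr rho mu),
      forall phi : nat -> R -> R[i], subseq_dense phi ->
        connected (Fr rho mu : set (radon_metric phi))
    & forall t : {posnum R},
        Ft rho t @` Fr rho mu `<=` Fr rho mu /\
        set_bij (Fr rho mu) (Fr rho mu) (Ft rho t)].
Proof.
split.
- by split; [exact: Fr_nonempty|exact: Fr_compact].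
- by move=> phi [Phi_phi _]; exact: Fr_connected.
- move=> t; split; last exact: Ft_bij.
  by move=> _ [nu Fnu <-]; exact: Ft_Fr.
Qed.
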